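(* Consider a bipartite system $\mathbb{C}^n=\mathbb{C}^{n_1}\otimes\mathbb{C}^{n_2}$, $n=n_1n_2$, in which at least one of the subsystems is a qubit (i.e. $n_1=2$ or $n_2=2$). Then the Rains bound and the relative entropy of entanglement coincide: $R(\rho)=E_{\mathcal{P}}(\rho)$ for all states $\rho\in H_{n,+,1}$.
   Context: $H_{n,+}$ denotes the positive semidefinite $n\times n$ hermitian matrices and $H_{n,+,1}$ those of unit trace (states). $A^\Gamma$ denotes the partial transpose of $A$ with respect to one of the two tensor factors (the choice of factor does not affect the sets below). $\mathcal{P}=\{\sigma\in H_{n,+,1}:\sigma^\Gamma\ge0\}$ is the set of PPT states, and $\mathcal{T}=\{\tau\in H_{n,+}:\mathrm{Tr}|\tau^\Gamma|\le1\}$, where $|A|=\sqrt{A^\dagger A}$. The relative entropy of $\rho\in H_{n,+,1}$ and $\sigma\in H_{n,+}$ is $S(\rho\|\sigma)=\mathrm{Tr}[\rho(\log\rho-\log\sigma)]$ (natural logarithm, with $0\log0=0$ and $\log\sigma$ taken on the support of $\sigma$) if $\ker\sigma\subseteq\ker\rho$, and $S(\rho\|\sigma)=+\infty$ otherwise. The relative entropy of entanglement (with respect to PPT states) is $E_{\mathcal{P}}(\rho)=\min_{\sigma\in\mathcal{P}}S(\rho\|\sigma)$. The Rains bound is $R(\rho)=\min_{\sigma\in H_{n,+,1}}\left(S(\rho\|\sigma)+\log\mathrm{Tr}|\sigma^\Gamma|\right)$, equivalently $R(\rho)=\min_{\tau\in\mathcal{T}}S(\rho\|\tau)$. *)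

(* Defs.v *)
(* Operators on C^n are matrices 'M[R[i]]_n over the complex numbers R[i], for an
   arbitrary model R : realType of the real numbers. *)
From HB Require Import structures.
From mathcomp Require Import all_boot all_order all_algebra.
From mathcomp Require Import complex mxtens.
From mathcomp Require Import boolp classical_sets reals constructive_ereal ereal.
From mathcomp Require Import topology normedtype exp.

Set Implicit Arguments.
Unset Strict Implicit.
Unset Printing Implicit Defensive.

Import Order.TTheory GRing.Theory Num.Theory.

Local Open Scope classical_set_scope.
Local Open Scope ring_scope.
Local Open Scope sesquilinear_scope.

Section Operators.
Context {R : realType} {n : nat}.
Implicit Types A rho sigma : 'M[R[i]]_n.

(* On R[i], [0 <= z] says that z is real and nonnegative. *)
Definition psd A : Prop :=
  A \is hermsymmx /\ forall v : 'cV[R[i]]_n, 0 <= (v ^t* *m A *m v) 0 0.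

Definition is_state A : Prop := psd A /\ \tr A = 1.

(* Functional calculus f(A) for a hermitian A, from a unitary diagonalization
   of A.  The eigenvalues are then real, so taking their real part only adjusts
   the type; the result does not depend on the diagonalization chosen by
   [spectralmx].  The value is unspecified when A is not hermitian. *)
Definition mxfun (f : R -> R) A : 'M[R[i]]_n :=
  invmx (spectralmx A)
  *m diag_mx (map_mx (fun z : R[i] => real_complex R (f (complex.Re z)))
                     (spectral_diag A))
  *m spectralmx A.

(* The logarithm on the support, extended by 0 on the kernel. *)
Definition logmx A := mxfun (fun x => if 0 < x then ln x else 0) A.

Definition absmx A := mxfun Num.sqrt (A ^t* *m A).

Definition trnorm A : R := complex.Re (\tr (absmx A)).

Definition kernel_sub sigma rho : Prop :=
  forall v : 'cV[R[i]]_n, sigma *m v = 0 -> rho *m v = 0.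

(* The trace is real for hermitian rho and sigma. *)
Definition relative_entropy rho sigma : \bar R :=
  if `[< kernel_sub sigma rho >]
  then (complex.Re (\tr (rho *m (logmx rho - logmx sigma))))%:E
  else +oo%E.

End Operators.

Section Bipartite.
Context {R : realType} {n1 n2 : nat}.
Implicit Types A rho sigma : 'M[R[i]]_(n1 * n2).

(* Partial transpose on the second factor, C^(n1 * n2) being identified with
   C^n1 (x) C^n2 through e_(i1 * n2 + i2) = e_i1 (x) e_i2. *)
Definition ptranspose A : 'M[R[i]]_(n1 * n2) :=
  \matrix_(i, j)
    let i12 := mxtens_unindex i in
    let j12 := mxtens_unindex j in
    A (mxtens_index (i12.1, j12.2)) (mxtens_index (j12.1, i12.2)).

Definition is_ppt_state A : Prop := is_state A /\ psd (ptranspose A).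

End Bipartite.

Definition is_minimum {R : realType} (S : set (\bar R)) (m : \bar R) : Prop :=
  S m /\ lbound S m.

Lemma is_minimum_unique {R : realType} (S : set (\bar R)) (m m' : \bar R) :
  is_minimum S m -> is_minimum S m' -> m = m'.
Proof.
move=> [Sm lbm] [Sm' lbm']; apply: le_anti.
by rewrite lbm // lbm'.
Qed.

(* A minimum is specified as a value that is attained and is a lower bound, so
   [is_E_P rho e] reads "E_P(rho) = e", and similarly for the Rains bound. *)
Definition is_E_P {R : realType} {n1 n2 : nat}
    (rho : 'M[R[i]]_(n1 * n2)) (e : \bar R) : Prop :=
  is_minimum [set relative_entropy rho sigma | sigma in is_ppt_state] e.

Definition is_rains_bound {R : realType} {n1 n2 : nat}
    (rho : 'M[R[i]]_(n1 * n2)) (r : \bar R) : Prop :=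
  is_minimum
    [set (relative_entropy rho sigma + (ln (trnorm (ptranspose sigma)))%:E)%E
       | sigma in is_state] r.

(* Main.v *)
(* Let G denote partial transposition and |A|_1 = Tr|A|.  Replacing a state sigma by
   tau = sigma / |sigma^G|_1 turns the Rains bound into the minimum of -Tr rho log tau
   over the tau >= 0 with |tau^G|_1 <= 1; PPT states are such tau, and the point is that
   the others do not do better.

   log is replaced by a Riemann sum g of
     log x = \int_0^1 (x - 1) / (1 + u (x - 1)) du,
   a rational function, so that Tr rho g(tau) is differentiated by the resolvent
   identity.  The right sums lie below log, which keeps the optimal tau away from the
   singular matrices; the left sums lie above log and are continuous on the positive
   semidefinite cone, which gives the lower semicontinuity of the relative entropy and
   hence the minimum over PPT states.

   Let rho > 0 and write tau^G = P - N with P, N >= 0 and Tr P + Tr N <= 1.  At an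
   optimal (P, N) the gradient phi > 0 satisfies Tr phi (p - q)^G <= c := Tr phi tau for
   all competitors (p, q), so that phi^G <= c.  If one factor is a qubit, this forces
   phi^G > -c: let psi be phi or its transpose, according to which factor is the qubit,
   X the bit flip of the qubit and D the qubit-block-diagonal part of psi, which is also
   that of phi^G.  Then phi^G + X D X = X psi X + D > 0 and X D X <= c.
   Now c = Tr phi^G (P - N) <= c Tr P - Tr phi^G N <= c - Tr (c + phi^G) N forces N = 0,
   i.e. tau^G >= 0, and tau / Tr tau is a PPT state at least as good as tau.

   A general rho is reached from (1 - e) rho + (e / n) 1 as e tends to 0. *)

Require Import Defs.
From mathcomp Require Import all_boot all_order all_algebra.
From mathcomp Require Import complex mxtens ring lra.
From mathcomp Require Import boolp classical_sets reals constructive_ereal ereal.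
From mathcomp Require Import topology normedtype sequences exp.

Set Implicit Arguments.
Unset Strict Implicit.
Unset Printing Implicit Defensive.

Import Order.TTheory GRing.Theory Num.Theory.
Import numFieldNormedType.Exports.

Local Open Scope classical_set_scope.
Local Open Scope ring_scope.
Local Open Scope sesquilinear_scope.

(** * Complex matrices and quadratic forms *)

Section ComplexParts.
Variable R : realType.
Implicit Types (x y z : R[i]) (a : R).

Lemma RecD x y : complex.Re (x + y) = complex.Re x + complex.Re y.
Proof. by case: x; case: y. Qed.

Lemma ImcD x y : complex.Im (x + y) = complex.Im x + complex.Im y.
Proof. by case: x; case: y. Qed.

Lemma RecN x : complex.Re (- x) = - complex.Re x.
Proof. by case: x. Qed.

Lemma ImcN x : complex.Im (- x) = - complex.Im x.
Proof. by case: x. Qed.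

Lemma RecB x y : complex.Re (x - y) = complex.Re x - complex.Re y.
Proof. by rewrite RecD RecN. Qed.

Lemma RecM x y : complex.Re (x * y) =
  complex.Re x * complex.Re y - complex.Im x * complex.Im y.
Proof. by case: x; case: y. Qed.

Lemma ImcM x y : complex.Im (x * y) =
  complex.Re x * complex.Im y + complex.Im x * complex.Re y.
Proof. by case: x; case: y. Qed.

Lemma RecZ a z : complex.Re (real_complex R a * z) = a * complex.Re z.
Proof. by rewrite RecM /= mul0r subr0. Qed.

Lemma Rec_conj z : complex.Re z^* = complex.Re z.
Proof. by case: z. Qed.

Lemma Imc_conj z : complex.Im z^* = - complex.Im z.
Proof. by case: z. Qed.

Lemma conj_real a : (real_complex R a)^* = real_complex R a.
Proof. by rewrite /Num.conj /= oppr0. Qed.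

Lemma Rec_sum (I : Type) (r : seq I) (P : pred I) (F : I -> R[i]) :
  complex.Re (\sum_(i <- r | P i) F i) = \sum_(i <- r | P i) complex.Re (F i).
Proof. exact: (big_morph _ RecD). Qed.

Lemma complex_ge0 z : (0 <= z) = (complex.Im z == 0) && (0 <= complex.Re z).
Proof. by rewrite lecE. Qed.

Definition sqnormc z : R := complex.Re z ^+ 2 + complex.Im z ^+ 2.

Lemma sqnormc_ge0 z : 0 <= sqnormc z.
Proof. by rewrite addr_ge0 ?sqr_ge0. Qed.

Lemma sqnormc_eq0 z : sqnormc z = 0 -> z = 0.
Proof.
move=> /eqP; rewrite paddr_eq0 ?sqr_ge0 // !sqrf_eq0.
by case: z => a b /= /andP[/eqP -> /eqP ->].
Qed.

Lemma mul_conj_sqnormc z : z^* * z = real_complex R (sqnormc z).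
Proof. by case: z => a b; rewrite /sqnormc /=; congr Complex; ring. Qed.

End ComplexParts.

Section QuadraticForms.
Variables (R : realType) (n : nat).
Implicit Types (A B : 'M[R[i]]_n) (v w : 'cV[R[i]]_n).

Lemma adjmxM m p q (A : 'M[R[i]]_(m, p)) (B : 'M[R[i]]_(p, q)) :
  (A *m B)^t* = B^t* *m A^t*.
Proof. by rewrite trmx_mul map_mxM. Qed.

Lemma adjmxD m p (A B : 'M[R[i]]_(m, p)) : (A + B)^t* = A^t* + B^t*.
Proof. by apply/matrixP => i j; rewrite !mxE rmorphD. Qed.

Lemma adjmxZ m p (a : R) (A : 'M[R[i]]_(m, p)) :
  (real_complex R a *: A)^t* = real_complex R a *: A^t*.
Proof. by apply/matrixP => i j; rewrite !mxE rmorphM /= conj_real. Qed.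

Lemma adjmxN m p (A : 'M[R[i]]_(m, p)) : (- A)^t* = - A^t*.
Proof. by apply/matrixP => i j; rewrite !mxE rmorphN. Qed.

Lemma adjmx_real (a : R) : ((real_complex R a)%:M : 'M[R[i]]_n)^t* = (real_complex R a)%:M.
Proof.
apply/matrixP => i j; rewrite !mxE eq_sym; case: (i == j) => /=.
  by rewrite mulr1n conj_real.
by rewrite mulr0n rmorph0.
Qed.

Lemma mxtraceB A B : \tr (A - B) = \tr A - \tr B.
Proof. by rewrite /mxtrace -sumrB; apply: eq_bigr => i _; rewrite !mxE. Qed.

(** Taking the real part makes the form [R]-valued, so that positivity becomes an inequality in [R];
    for hermitian [A] nothing is lost, by [Im_qf]. *)
Definition qf A v : R := complex.Re ((v^t* *m A *m v) 0 0).

Lemma qfE A v : qf A v = \sum_i \sum_j complex.Re ((v i 0)^* * A i j * v j 0).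
Proof.
rewrite /qf mxE Rec_sum exchange_big; apply: eq_bigr => j _.
by rewrite mxE mulr_suml Rec_sum; apply: eq_bigr => i _; rewrite !mxE.
Qed.

Lemma qfD A B v : qf (A + B) v = qf A v + qf B v.
Proof. by rewrite /qf mulmxDr mulmxDl mxE RecD. Qed.

Lemma qfN A v : qf (- A) v = - qf A v.
Proof. by rewrite /qf mulmxN mulNmx mxE RecN. Qed.

Lemma qfZ (a : R) A v : qf (real_complex R a *: A) v = a * qf A v.
Proof. by rewrite /qf -scalemxAr -scalemxAl mxE RecZ. Qed.

Lemma qf_sum (I : Type) (r : seq I) (F : I -> 'M[R[i]]_n) v :
  qf (\sum_(k <- r) F k) v = \sum_(k <- r) qf (F k) v.
Proof.
elim: r => [|k r IH]; first by rewrite !big_nil /qf mulmx0 mul0mx mxE.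
by rewrite !big_cons qfD IH.
Qed.

Lemma qf_scalar (a : R) v : qf (real_complex R a)%:M v = a * \sum_i sqnormc (v i 0).
Proof.
rewrite /qf mul_mx_scalar -scalemxAl mxE RecZ mxE Rec_sum; congr (_ * _).
by apply: eq_bigr => i _; rewrite !mxE mul_conj_sqnormc.
Qed.

Lemma qf_congr m (B : 'M[R[i]]_m) (K : 'M[R[i]]_(m, n)) v :
  qf (K^t* *m B *m K) v =
  complex.Re (((K *m v)^t* *m B *m (K *m v)) 0 0).
Proof. by rewrite /qf adjmxM !mulmxA. Qed.

Lemma sqnorm_gt0 v : v != 0 -> 0 < \sum_i sqnormc (v i 0).
Proof.
move=> v0; rewrite lt_neqAle sumr_ge0 ?andbT; last by move=> i _; exact: sqnormc_ge0.
apply: contra v0; rewrite eq_sym psumr_eq0; last by move=> i _; exact: sqnormc_ge0.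
move=> /allP h; apply/eqP/matrixP => i j; rewrite ord1 mxE.
by apply: sqnormc_eq0; apply/eqP; apply: h; rewrite mem_index_enum.
Qed.

Lemma hermP m (A : 'M[R[i]]_m) : A \is hermsymmx <-> A^t* = A.
Proof.
split=> [/is_hermitianmxP|h]; first by rewrite expr0 scale1r => {2}->.
by apply/is_hermitianmxP; rewrite expr0 scale1r h.
Qed.

Lemma Im_qf A v : A^t* = A -> complex.Im ((v^t* *m A *m v) 0 0) = 0.
Proof.
move=> hA; set z := _ 0 0.
suff /(congr1 (@complex.Im R)) : z^* = z by rewrite Imc_conj; lra.
have -> : z^* = ((v^t* *m A *m v)^t*) 0 0 by rewrite [RHS]mxE [in RHS]mxE.
by rewrite !adjmxM trmxCK hA mulmxA.
Qed.

Lemma psdE A : psd A <-> A^t* = A /\ forall v, 0 <= qf A v.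
Proof.
split=> [[/hermP hA pA]|[hA pA]]; split=> //.
- by move=> v; have := pA v; rewrite complex_ge0 => /andP[].
- exact/hermP.
- by move=> v; rewrite complex_ge0 Im_qf // eqxx pA.
Qed.

Definition pd A : Prop := A^t* = A /\ forall v, v != 0 -> 0 < qf A v.

Lemma pd_psd A : pd A -> psd A.
Proof.
move=> [hA pA]; apply/psdE; split=> // v; have [->|v0] := eqVneq v 0.
  by rewrite /qf mulmx0 mxE.
exact/ltW/pA.
Qed.

Lemma psdD A B : psd A -> psd B -> psd (A + B).
Proof.
move=> /psdE[hA pA] /psdE[hB pB]; apply/psdE; split; first by rewrite adjmxD hA hB.
by move=> v; rewrite qfD addr_ge0.
Qed.

Lemma psdZ (a : R) A : 0 <= a -> psd A -> psd (real_complex R a *: A).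
Proof.
move=> a0 /psdE[hA pA]; apply/psdE; split; first by rewrite adjmxZ hA.
by move=> v; rewrite qfZ mulr_ge0.
Qed.

Lemma psd_real (a : R) : 0 <= a -> psd ((real_complex R a)%:M : 'M[R[i]]_n).
Proof.
move=> a0; apply/psdE; split; first exact: adjmx_real.
by move=> v; rewrite qf_scalar mulr_ge0 // sumr_ge0 // => i _; exact: sqnormc_ge0.
Qed.

Lemma psd0 : psd (0 : 'M[R[i]]_n).
Proof.
apply/psdE; split; first by apply/matrixP => i j; rewrite !mxE rmorph0.
by move=> v; rewrite /qf mulmx0 mul0mx mxE.
Qed.

Lemma psd_congr m (B : 'M[R[i]]_m) (K : 'M[R[i]]_(m, n)) :
  psd B -> psd (K^t* *m B *m K).
Proof.
move=> [/hermP hB pB]; apply/psdE; split; first by rewrite !adjmxM trmxCK hB mulmxA.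
by move=> v; rewrite qf_congr; have := pB (K *m v); rewrite complex_ge0 => /andP[].
Qed.

Lemma pd_unit A : pd A -> A \in unitmx.
Proof.
move=> [hA pA]; rewrite -unitmx_tr -row_free_unit -kermx_eq0.
apply/negPn/negP => /rowV0Pn[u /sub_kermxP uA u0].
have u'0 : u^T != 0 by apply: contra u0 => /eqP h; rewrite -[u]trmxK h trmx0.
have := pA _ u'0; rewrite /qf -mulmxA.
by rewrite -[A *m u^T]trmxK trmx_mul trmxK uA trmx0 mulmx0 mxE ltxx.
Qed.

End QuadraticForms.

(** * Functional calculus *)

Section SpectralCalculus.
Variables (R : realType) (n : nat).
Implicit Types (A B rho : 'M[R[i]]_n) (U V : 'M[R[i]]_n) (d e : 'I_n -> R).

Definition rdiag d : 'M[R[i]]_n := diag_mx (\row_i real_complex R (d i)).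

Lemma rdiagM d e : rdiag d *m rdiag e = rdiag (fun i => d i * e i).
Proof.
rewrite /rdiag mul_diag_mx; apply/matrixP => i j.
by rewrite !mxE rmorphM mulrnAr.
Qed.

Lemma rdiagD d e : rdiag d + rdiag e = rdiag (fun i => d i + e i).
Proof.
by apply/matrixP => i j; rewrite !mxE rmorphD mulrnDl.
Qed.

Lemma rdiagN d : - rdiag d = rdiag (fun i => - d i).
Proof. by apply/matrixP => i j; rewrite !mxE rmorphN mulNrn. Qed.

Lemma rdiagZ (a : R) d : real_complex R a *: rdiag d = rdiag (fun i => a * d i).
Proof.
by apply/matrixP => i j; rewrite !mxE rmorphM mulrnAr.
Qed.

Lemma rdiag_const (a : R) : rdiag (fun=> a) = (real_complex R a)%:M.
Proof. by apply/matrixP => i j; rewrite !mxE. Qed.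

Lemma rdiag_herm d : (rdiag d)^t* = rdiag d.
Proof.
apply/matrixP => i j; rewrite !mxE eq_sym; case: eqVneq => [->|_] /=.
  by rewrite !mulr1n conj_real.
by rewrite !mulr0n rmorph0.
Qed.

(** Hermitian matrices are handled through an arbitrary unitary [U] and real eigenvalues [d]; the
    eigenvectors are the columns of the adjoint of [U]. *)
Definition udiag U d : 'M[R[i]]_n := U^t* *m rdiag d *m U.

(** The diagonal of [rho] in the eigenbasis given by a unitary [U]: for a state, the outcome
    distribution of a measurement in that basis. *)
Definition weight U rho i : R := complex.Re ((U *m rho *m U^t*) i i).

Lemma unitary_mulVmx U : U \is unitarymx -> U^t* *m U = 1%:M.
Proof. by move=> hU; rewrite -invmx_unitary // mulVmx // unitarymx_unit. Qed.

Lemma eq_udiag U d e : d =1 e -> udiag U d = udiag U e.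
Proof.
by move=> /funext ->.
Qed.

Lemma udiagM U d e : U \is unitarymx -> udiag U d *m udiag U e = udiag U (fun i => d i * e i).
Proof.
move=> /unitarymxP; rewrite /udiag -rdiagM; move: (U^t*) => U' hU.
by rewrite -!mulmxA (mulmxA U U') hU mul1mx.
Qed.

Lemma udiagD U d e : udiag U d + udiag U e = udiag U (fun i => d i + e i).
Proof. by rewrite /udiag -mulmxDl -mulmxDr rdiagD. Qed.

Lemma udiagN U d : - udiag U d = udiag U (fun i => - d i).
Proof. by rewrite /udiag -rdiagN mulmxN mulNmx. Qed.

Lemma udiagZ U (a : R) d : real_complex R a *: udiag U d = udiag U (fun i => a * d i).
Proof. by rewrite /udiag scalemxAl scalemxAr rdiagZ. Qed.

Lemma udiag_const U (a : R) : U \is unitarymx -> udiag U (fun=> a) = (real_complex R a)%:M.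
Proof.
move=> hU; rewrite /udiag rdiag_const mul_mx_scalar -scalemxAl unitary_mulVmx //.
by rewrite scale_scalar_mx mulr1.
Qed.

Lemma udiag_herm U d : (udiag U d)^t* = udiag U d.
Proof. by rewrite /udiag !adjmxM trmxCK rdiag_herm mulmxA. Qed.

Lemma invmx_udiag U d : U \is unitarymx -> (forall i, d i != 0) ->
  invmx (udiag U d) = udiag U (fun i => (d i)^-1).
Proof.
move=> hU d0; have h : udiag U d *m udiag U (fun i => (d i)^-1) = 1%:M.
  rewrite udiagM // -[1%:M](udiag_const 1 hU); apply: eq_udiag => i; exact: divff.
have [uA _] := mulmx1_unit h.
by rewrite -[LHS]mulmx1 -h mulKmx.
Qed.

Lemma spectralmx_udiag A : A \is hermsymmx ->
  A = udiag (spectralmx A) (fun i => complex.Re (spectral_diag A 0 i)).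
Proof.
move=> hA; have /hermitian_normalmx/orthomx_spectralP := hA.
rewrite invmx_unitary ?spectral_unitarymx // => {1}->; rewrite /udiag /rdiag.
rewrite (_ : \row_i _ = spectral_diag A) //; apply/matrixP => k i; rewrite mxE ord1.
by rewrite RRe_real //; have /mxOverP := hermitian_spectral_diag_real hA; apply.
Qed.

Lemma herm_udiag A : A^t* = A -> exists U d, U \is unitarymx /\ A = udiag U d.
Proof.
move=> /hermP hA; exists (spectralmx A), (fun i => complex.Re (spectral_diag A 0 i)).
split; [exact: spectral_unitarymx | exact: spectralmx_udiag].
Qed.

(* V U^* intertwines diag(d) and diag(e) entrywise, hence also their images under f. *)
Lemma udiag_fun U V d e (f : R -> R) : U \is unitarymx -> V \is unitarymx ->
  udiag U d = udiag V e -> udiag U (f \o d) = udiag V (f \o e).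
Proof.
move=> hU hV; rewrite /udiag; set D := rdiag d; set E := rdiag e; set D' := rdiag _;
  set E' := rdiag _.
move: (unitarymxP hU) (unitary_mulVmx hU) (unitary_mulVmx hV) (unitarymxP hV).
move: (U^t*) (V^t*) => U' V' UU' U'U V'V VV' h.
have hW : V *m U' *m D = E *m (V *m U').
  have := congr1 (fun X => V *m X *m U') h.
  by rewrite !mulmxA VV' mul1mx -!mulmxA UU' mulmx1.
have hW' : V *m U' *m D' = E' *m (V *m U').
  apply/matrixP => i j; have /matrixP/(_ i j) := hW; rewrite !mul_mx_diag !mul_diag_mx !mxE.
  set w := \sum_k _; rewrite [_ * w]mulrC => /eqP; rewrite -subr_eq0 -mulrBr mulf_eq0.
  case/orP => [/eqP -> |]; first by rewrite !(mul0r, mulr0).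
  by rewrite subr_eq0 => /eqP [/= ->]; rewrite mulrC.
rewrite -[LHS]mul1mx -V'V -mulmxA [V *m _]mulmxA [V *m _]mulmxA hW'.
by rewrite -!mulmxA U'U mulmx1.
Qed.

(** Frees the functional calculus from the diagonalization picked by [spectralmx], by means of
    [udiag_fun]. *)
Lemma mxfun_udiag (f : R -> R) U d : U \is unitarymx ->
  mxfun f (udiag U d) = udiag U (f \o d).
Proof.
move=> hU; have /hermP hA := udiag_herm U d; set A := udiag U d.
rewrite /mxfun invmx_unitary ?spectral_unitarymx //.
transitivity (udiag (spectralmx A) (f \o (fun i => complex.Re (spectral_diag A 0 i)))).
  rewrite /udiag /rdiag (_ :
    map_mx _ _ = \row_i real_complex R (f (complex.Re (spectral_diag A 0 i)))) //.
  by apply/matrixP => k i; rewrite !mxE ord1.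
by apply: udiag_fun; rewrite ?spectral_unitarymx // -spectralmx_udiag.
Qed.

Lemma Re_tr_udiag rho U d : complex.Re (\tr (rho *m udiag U d)) = \sum_i weight U rho i * d i.
Proof.
rewrite /udiag mulmxA mxtrace_mulC !mulmxA /mxtrace Rec_sum; apply: eq_bigr => i _.
by rewrite mul_mx_diag mxE [X in _ * X]mxE mulrC RecZ mulrC.
Qed.

Lemma mulmx_col m p q (A : 'M[R[i]]_(m, p)) (B : 'M[R[i]]_(p, q)) j :
  A *m col j B = col j (A *m B).
Proof. by rewrite !colE mulmxA. Qed.

Lemma weightE U rho i : weight U rho i = qf rho (col i (U^t*)).
Proof.
rewrite /weight /qf; congr (complex.Re _).
have -> : (col i (U^t*))^t* = row i U by apply/matrixP => a b; rewrite !mxE conjCK.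
by rewrite mulmx_col -!row_mul [RHS]mxE [RHS]mxE.
Qed.

Lemma weight_ge0 U rho i : psd rho -> 0 <= weight U rho i.
Proof. by move=> /psdE[_ h]; rewrite weightE. Qed.

Lemma weight_sum U rho : U \is unitarymx -> \sum_i weight U rho i = complex.Re (\tr rho).
Proof.
move=> hU; rewrite -[RHS](_ : complex.Re (\tr (rho *m udiag U (fun=> 1))) = _).
  by rewrite Re_tr_udiag; apply: eq_bigr => i _; rewrite mulr1.
by rewrite udiag_const // mulmx1.
Qed.

Lemma weight_udiag U d i : U \is unitarymx -> weight U (udiag U d) i = d i.
Proof.
move=> hU; rewrite /weight /udiag !mulmxA (unitarymxP hU) mul1mx -mulmxA (unitarymxP hU) mulmx1.
by rewrite !mxE eqxx mulr1n.
Qed.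

Lemma weightD U A B i : weight U (A + B) i = weight U A i + weight U B i.
Proof. by rewrite !weightE qfD. Qed.

Lemma weightZ U (a : R) A i : weight U (real_complex R a *: A) i = a * weight U A i.
Proof. by rewrite !weightE qfZ. Qed.

Lemma weight_const U (a : R) i : U \is unitarymx -> weight U (real_complex R a)%:M i = a.
Proof. by move=> hU; rewrite -(udiag_const _ hU) weight_udiag. Qed.

Lemma udiag_psd U d : (forall i, 0 <= d i) -> psd (udiag U d).
Proof.
move=> d0; apply: psd_congr; apply/psdE; split; first exact: rdiag_herm.
move=> v; rewrite /qf mxE Rec_sum sumr_ge0 // => i _.
rewrite mul_mx_diag !mxE mulrAC mulrC RecZ mulr_ge0 //.
by rewrite mul_conj_sqnormc sqnormc_ge0.
Qed.

Lemma psd_udiag A : psd A ->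
  exists U d, [/\ U \is unitarymx, A = udiag U d & forall i, 0 <= d i].
Proof.
move=> pA; have /psdE[/herm_udiag[U [d [hU hA]]] _] := pA.
by exists U, d; split=> // i; rewrite -(weight_udiag d i hU) -hA weight_ge0.
Qed.

Lemma unitary_col_neq0 U i : U \is unitarymx -> col i (U^t*) != 0.
Proof.
move=> hU; apply/eqP => h; have := weight_const 1 i hU.
by rewrite weightE h /qf mulmx0 mxE /= => /esym/eqP; rewrite oner_eq0.
Qed.

Lemma pd_weight_gt0 U rho i : U \is unitarymx -> pd rho -> 0 < weight U rho i.
Proof. by move=> hU [_ h]; rewrite weightE; apply/h/unitary_col_neq0. Qed.

Lemma Re_tr_psd_ge0 A B : psd A -> psd B -> 0 <= complex.Re (\tr (A *m B)).
Proof.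
move=> pA /psd_udiag[U [d [hU -> d0]]]; rewrite Re_tr_udiag sumr_ge0 // => i _.
by rewrite mulr_ge0 ?weight_ge0.
Qed.

(** In an eigenbasis of [B] the trace is a sum of nonnegative eigenvalues with strictly positive
    weights, so all of them vanish. This is how a negative part is shown to be zero. *)
Lemma Re_tr_pd_le0 A B : pd A -> psd B -> complex.Re (\tr (A *m B)) <= 0 -> B = 0.
Proof.
move=> pA /psd_udiag[U [d [hU -> d0]]]; rewrite Re_tr_udiag => le0.
have w0 i : 0 < weight U A i by exact: pd_weight_gt0.
have h0 i : 0 <= weight U A i * d i by rewrite mulr_ge0 // ltW.
have : \sum_i weight U A i * d i == 0 by rewrite eq_le le0 sumr_ge0.
rewrite psumr_eq0 // => /allP h.
have dE : d =1 fun=> 0.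
  by move=> i; have := h i (mem_index_enum _); rewrite /= mulf_eq0 gt_eqF //= => /eqP.
by rewrite (eq_udiag U dE) udiag_const // rmorph0.
Qed.

Lemma qf_udiag U d (v : 'cV[R[i]]_n) :
  qf (udiag U d) v = \sum_i d i * sqnormc ((U *m v) i 0).
Proof.
rewrite /udiag qf_congr mxE Rec_sum; apply: eq_bigr => i _.
by rewrite mul_mx_diag !mxE mulrAC mulrC RecZ mul_conj_sqnormc.
Qed.

Lemma udiag_pd U d : U \is unitarymx -> (forall i, 0 < d i) -> pd (udiag U d).
Proof.
move=> hU d0; split; first exact: udiag_herm.
move=> v v0; have pU : psd (udiag U d) by apply: udiag_psd => i; exact: ltW.
have /psdE[_ /(_ v) h] := pU; rewrite lt_neqAle h andbT eq_sym.
apply/eqP; rewrite qf_udiag => /eqP; rewrite psumr_eq0 => [/allP hs|i _]; last first.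
  by rewrite mulr_ge0 ?sqnormc_ge0 // ltW.
have Uv : U *m v = 0.
  apply/matrixP => i j; rewrite ord1 [RHS]mxE; apply: sqnormc_eq0; apply/eqP.
  by have := hs i (mem_index_enum _); rewrite /= mulf_eq0 gt_eqF.
by move: v0; rewrite -[v]mul1mx -(unitary_mulVmx hU) -mulmxA Uv mulmx0 eqxx.
Qed.

Lemma psd_qf_eq0 A (v : 'cV[R[i]]_n) : psd A -> qf A v = 0 -> A *m v = 0.
Proof.
move=> /psd_udiag[U [d [hU -> d0]]].
rewrite qf_udiag => /eqP; rewrite psumr_eq0 => [/allP h|i _]; last by rewrite mulr_ge0 ?sqnormc_ge0.
rewrite /udiag -!mulmxA; move: (U *m v) h => w h.
suff -> : rdiag d *m w = 0 by rewrite mulmx0.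
apply/matrixP => i j; rewrite ord1 mul_diag_mx !mxE; have /= := h i (mem_index_enum _).
by rewrite mulf_eq0 => /orP[/eqP ->|/eqP /sqnormc_eq0 ->]; rewrite ?mul0r ?mulr0.
Qed.

(** Turns the support condition of the relative entropy into one on scalars. A zero weight is enough
    because [rho] annihilates any vector at which its form vanishes ([psd_qf_eq0]). *)
Lemma kernel_sub_udiag rho U d : psd rho -> U \is unitarymx ->
  kernel_sub (udiag U d) rho <-> forall i, d i = 0 -> weight U rho i = 0.
Proof.
move=> prho hU; split=> [h i di|h v].
  rewrite weightE /qf -mulmxA h ?mulmx0 ?mxE // /udiag -!mulmxA.
  have -> : U *m col i (U^t*) = delta_mx i 0.
    by rewrite mulmx_col (unitarymxP hU) colE mul1mx.
  apply/matrixP => a b; rewrite !mxE big1 // => k _; rewrite mul_diag_mx !mxE.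
  by case: eqVneq => [->|_]; rewrite ?di ?rmorph0 ?mul0r ?mulr0.
rewrite /udiag -mulmxA => hv.
have hDv : rdiag d *m (U *m v) = 0.
  have := congr1 (mulmx U) hv; rewrite mulmx0 !mulmxA (unitarymxP hU) mul1mx.
  by rewrite -mulmxA.
(* Expand [v] in the eigenbasis: where [d i = 0], [rho] kills the eigenvector; elsewhere the
   coordinate of [v] is zero. *)
rewrite -[v]mul1mx -(unitary_mulVmx hU) -[_ *m U *m v]mulmxA mulmxA.
move: (U *m v) hDv => w hDv; apply/matrixP => a b; rewrite !mxE big1 // => i _.
have [di|di] := eqVneq (d i) 0.
  have /psd_qf_eq0 : qf rho (col i (U^t*)) = 0 by rewrite -weightE h.
  by move=> /(_ prho)/matrixP/(_ a 0); rewrite mulmx_col !mxE => ->; rewrite mul0r.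
have /matrixP/(_ i b) := hDv; rewrite mul_diag_mx !mxE => /eqP.
rewrite mulf_eq0 => /orP[|/eqP ->]; last by rewrite mulr0.
by rewrite (fmorph_eq0 (real_complex R)) (negPf di).
Qed.

End SpectralCalculus.

(** * Rational approximations of the logarithm *)

Section RiemannSums.
Variable R : realType.
Implicit Types (u x y : R) (k b : nat).

(* ln x is the integral of [ln_integrand u x] over u in [0, 1]; [ln_riemann k 0] and
   [ln_riemann k 1] are its left and right Riemann sums, and the integrand decreases in u. *)
Definition ln_integrand u x : R := (x - 1) / (1 + u * (x - 1)).

Definition ln_riemann k b x : R := k%:R^-1 * \sum_(j < k) ln_integrand ((j + b)%:R / k%:R) x.

(** Right sums reach the node [u = 1] and need [x > 0]; left sums stop before it and tolerate
    [x = 0], as in [ln_integrand_den_ge0]. *)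
Lemma ln_integrand_den_gt0 u x : 0 <= u -> u <= 1 -> 0 < x -> 0 < 1 + u * (x - 1).
Proof.
move=> u0 u1 x0; have [->|un1] := eqVneq u 1; first by lra.
have {}u1 : u < 1 by rewrite lt_neqAle un1.
nra.
Qed.

Lemma ln_integrand_den_ge0 u x : 0 <= u -> u < 1 -> 0 <= x -> 0 < 1 + u * (x - 1).
Proof. by move=> u0 u1 x0; nra. Qed.

Lemma le_ln_integrand u x y : 0 <= u -> u < 1 -> 0 <= x -> x <= y ->
  ln_integrand u x <= ln_integrand u y.
Proof.
move=> u0 u1 x0 xy; have y0 := le_trans x0 xy.
have hx := ln_integrand_den_ge0 u0 u1 x0; have hy := ln_integrand_den_ge0 u0 u1 y0.
by rewrite /ln_integrand ler_pdivrMr // mulrAC ler_pdivlMr //; nra.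
Qed.

(** The integrand is the derivative of [ln (1 + u * (x - 1))] in [u]; both bounds on the increment
    follow from [ln (1 + y) <= y] alone. *)
Lemma ln_integrand_ln_step u v x : 0 <= u -> u <= v -> v <= 1 -> 0 < x ->
  (v - u) * ln_integrand v x <= ln (1 + v * (x - 1)) - ln (1 + u * (x - 1)) <=
    (v - u) * ln_integrand u x.
Proof.
move=> u0 uv v1 x0.
have hu : 0 < 1 + u * (x - 1) by rewrite ln_integrand_den_gt0 // (le_trans uv).
have hv : 0 < 1 + v * (x - 1) by rewrite ln_integrand_den_gt0 // (le_trans u0).
rewrite /ln_integrand; move: hu hv.
set a := 1 + u * _; set c := 1 + v * _ => a0 c0.
have hac : c - a = (v - u) * (x - 1) by rewrite /a /c; ring.
have ln_le (s t : R) : 0 < s -> 0 < t -> ln s - ln t <= (s - t) / t.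
  move=> s0 t0; rewrite -ln_div ?posrE //.
  have st0 : 0 < s / t by rewrite divr_gt0.
  rewrite mulrBl divff ?gt_eqF // -[X in ln X](subrKC 1); apply: le_ln1Dx; lra.
rewrite !mulrA -hac; apply/andP; split; last exact: ln_le.
by rewrite -lerN2 opprB; apply: (le_trans (ln_le _ _ a0 c0)); rewrite -mulNr opprB.
Qed.

Lemma ln_telescope k x : (0 < k)%N ->
  ln x = \sum_(j < k) (ln (1 + j.+1%:R / k%:R * (x - 1)) - ln (1 + j%:R / k%:R * (x - 1))).
Proof.
move=> k0; pose L j := ln (1 + j%:R / k%:R * (x - 1)).
rewrite -(big_mkord predT (fun j => L j.+1 - L j)) telescope_sumr // /L.
by rewrite mul0r mul0r addr0 ln1 subr0 divff ?pnatr_eq0 -?lt0n // mul1r addrC subrK.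
Qed.

Lemma ln_riemann1_le_ln k x : (0 < k)%N -> 0 < x -> ln_riemann k 1 x <= ln x.
Proof.
move=> k0 x0; rewrite (ln_telescope x k0) /ln_riemann mulr_sumr; apply: ler_sum => j _.
have kR : 0 < k%:R :> R by rewrite ltr0n.
have j0 : 0 <= j%:R / k%:R :> R by rewrite divr_ge0 ?ler0n.
have jS : j%:R / k%:R <= j.+1%:R / k%:R :> R by rewrite ler_pM2r ?invr_gt0 // ler_nat.
have j1 : j.+1%:R / k%:R <= 1 :> R by rewrite ler_pdivrMr // mul1r ler_nat.
have /andP[+ _] := ln_integrand_ln_step j0 jS j1 x0.
by rewrite addn1 -mulrBl -natrB // subSnn mul1r.
Qed.

Lemma ln_le_ln_riemann0 k x : (0 < k)%N -> 0 < x -> ln x <= ln_riemann k 0 x.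
Proof.
move=> k0 x0; rewrite (ln_telescope x k0) /ln_riemann mulr_sumr; apply: ler_sum => j _.
have kR : 0 < k%:R :> R by rewrite ltr0n.
have j0 : 0 <= j%:R / k%:R :> R by rewrite divr_ge0 ?ler0n.
have jS : j%:R / k%:R <= j.+1%:R / k%:R :> R by rewrite ler_pM2r ?invr_gt0 // ler_nat.
have j1 : j.+1%:R / k%:R <= 1 :> R by rewrite ler_pdivrMr // mul1r ler_nat.
have /andP[_ +] := ln_integrand_ln_step j0 jS j1 x0.
by rewrite addn0 -mulrBl -natrB // subSnn mul1r.
Qed.

(** The two sums share all nodes but the extreme ones, so they differ by [1 / k] times the drop of
    the integrand from [x - 1] at [u = 0] to [(x - 1) / x] at [u = 1]. *)
Lemma ln_riemann_gap k x : (0 < k)%N -> 0 < x ->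
  ln_riemann k 0 x = ln_riemann k 1 x + (x - 1) ^+ 2 / (k%:R * x).
Proof.
move=> k0 x0; have kR : k%:R != 0 :> R by rewrite pnatr_eq0 -lt0n.
apply/eqP; rewrite addrC -subr_eq; apply/eqP.
rewrite /ln_riemann -mulrBr -sumrB.
pose H j := ln_integrand (j%:R / k%:R) x.
rewrite (eq_bigr (fun j : 'I_k => - (H j.+1 - H j))); last first.
  by move=> j _; rewrite addn0 addn1 opprB.
rewrite sumrN -(big_mkord predT (fun j => H j.+1 - H j)) telescope_sumr //.
rewrite /H /ln_integrand mul0r divff // mul0r; field.
by rewrite kR !gt_eqF //; lra.
Qed.

Lemma ln_le_ln_riemann1 k x : (0 < k)%N -> 0 < x -> x <= 1 ->
  ln x <= ln_riemann k 1 x + (k%:R * x)^-1.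
Proof.
move=> k0 x0 x1; apply: (le_trans (ln_le_ln_riemann0 k0 x0)); rewrite (ln_riemann_gap k0 x0) lerD2l.
rewrite ler_piMl ?invr_ge0 ?mulr_ge0 ?ler0n ?(ltW x0) //.
by rewrite -sqrrN opprB exprn_ile1 //; lra.
Qed.

Lemma ln_riemann0_le_ln k x : (0 < k)%N -> 0 < x -> x <= 1 ->
  ln_riemann k 0 x <= ln x + (k%:R * x)^-1.
Proof.
move=> k0 x0 x1; rewrite (ln_riemann_gap k0 x0) lerD ?ln_riemann1_le_ln //.
rewrite ler_piMl ?invr_ge0 ?mulr_ge0 ?ler0n ?(ltW x0) //.
by rewrite -sqrrN opprB exprn_ile1 //; lra.
Qed.

Lemma le_ln_riemann0 k x y : (0 < k)%N -> 0 <= x -> x <= y -> ln_riemann k 0 x <= ln_riemann k 0 y.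
Proof.
move=> k0 x0 xy; rewrite /ln_riemann ler_wpM2l ?invr_ge0 ?ler0n //; apply: ler_sum => j _.
have kR : 0 < k%:R :> R by rewrite ltr0n.
apply: le_ln_integrand => //; rewrite addn0 ?divr_ge0 ?ler0n //.
by rewrite ltr_pdivrMr // mul1r ltr_nat.
Qed.

End RiemannSums.

(** * Riemann sums of the logarithm at matrix arguments *)

Section MatrixRiemannSums.
Variables (R : realType) (n : nat).
Implicit Types (A B rho : 'M[R[i]]_n) (U : 'M[R[i]]_n) (d : 'I_n -> R) (u : R).

Definition ln_denom_mx u A : 'M[R[i]]_n := 1%:M + real_complex R u *: (A - 1%:M).

Definition ln_integrand_mx u A : 'M[R[i]]_n := (A - 1%:M) *m invmx (ln_denom_mx u A).

Lemma udiag_subr1 U d : U \is unitarymx -> udiag U d - 1%:M = udiag U (fun i => d i - 1).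
Proof. by move=> hU; rewrite -[1%:M](udiag_const 1 hU) udiagN udiagD. Qed.

Lemma ln_denom_mx_udiag u U d : U \is unitarymx ->
  ln_denom_mx u (udiag U d) = udiag U (fun i => 1 + u * (d i - 1)).
Proof.
by move=> hU; rewrite /ln_denom_mx udiag_subr1 // udiagZ -[1%:M](udiag_const 1 hU) udiagD.
Qed.

Lemma ln_integrand_mx_udiag u U d : U \is unitarymx -> (forall i, 1 + u * (d i - 1) != 0) ->
  ln_integrand_mx u (udiag U d) = udiag U (fun i => ln_integrand u (d i)).
Proof.
by move=> hU hd; rewrite /ln_integrand_mx ln_denom_mx_udiag // invmx_udiag // udiag_subr1 // udiagM.
Qed.

(** Resolvent identity. Put the denominator of [B] on the left and that of [A] on the right, which
    is possible since [B - 1] commutes with its own denominator. With [a = A - 1] and [b = B - 1]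
    the numerator is [a + u b a - b - u b a = a - b]. *)
Lemma ln_integrand_mx_sub u A B : ln_denom_mx u A \in unitmx -> ln_denom_mx u B \in unitmx ->
  ln_integrand_mx u A - ln_integrand_mx u B =
    invmx (ln_denom_mx u B) *m (A - B) *m invmx (ln_denom_mx u A).
Proof.
move=> uA uB; have hB : (B - 1%:M) *m ln_denom_mx u B = ln_denom_mx u B *m (B - 1%:M).
  by rewrite /ln_denom_mx mulmxDr mulmxDl mulmx1 mul1mx -scalemxAr -scalemxAl.
have -> : ln_integrand_mx u B = invmx (ln_denom_mx u B) *m (B - 1%:M).
  by rewrite /ln_integrand_mx -[B - 1%:M in LHS](mulKmx uB) -hB -!mulmxA (mulmxV uB) mulmx1.
rewrite /ln_integrand_mx -[A - 1%:M in LHS](mulKmx uB) -[B - 1%:M in LHS](mulmxK uA).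
rewrite -!mulmxA -mulmxBr; congr (_ *m _); rewrite !mulmxA -mulmxBl; congr (_ *m _).
have -> : A - B = (A - 1%:M) - (B - 1%:M) by rewrite opprB addrA subrK.
rewrite /ln_denom_mx; move: (A - 1%:M) (B - 1%:M) => a b.
rewrite mulmxDl mulmxDr mulmx1 mul1mx -scalemxAr -scalemxAl.
by rewrite opprD addrACA subrr addr0.
Qed.

Definition tr_ln_riemann rho k b A : R :=
  k%:R^-1 * \sum_(j < k) complex.Re (\tr (rho *m ln_integrand_mx ((j + b)%:R / k%:R) A)).

Lemma tr_ln_riemann_udiag rho k b U d : U \is unitarymx ->
  (forall (j : 'I_k) i, 1 + (j + b)%:R / k%:R * (d i - 1) != 0) ->
  tr_ln_riemann rho k b (udiag U d) = \sum_i weight U rho i * ln_riemann k b (d i).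
Proof.
move=> hU hd; rewrite /tr_ln_riemann.
under eq_bigr => j _ do rewrite ln_integrand_mx_udiag // Re_tr_udiag.
rewrite exchange_big mulr_sumr; apply: eq_bigr => i _.
by rewrite /ln_riemann mulrCA -mulr_sumr.
Qed.

Lemma tr_ln_riemann1_udiag rho k U d : (0 < k)%N -> U \is unitarymx -> (forall i, 0 < d i) ->
  tr_ln_riemann rho k 1 (udiag U d) = \sum_i weight U rho i * ln_riemann k 1 (d i).
Proof.
move=> k0 hU d0; apply: tr_ln_riemann_udiag => // j i; apply: lt0r_neq0;
  apply: ln_integrand_den_gt0; rewrite ?d0 //.
by rewrite ler_pdivrMr ?ltr0n // mul1r ler_nat addn1.
Qed.

(** Nonnegative eigenvalues suffice because the last node is [(k - 1) / k < 1]. *)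
Lemma tr_ln_riemann0_udiag rho k U d : (0 < k)%N -> U \is unitarymx -> (forall i, 0 <= d i) ->
  tr_ln_riemann rho k 0 (udiag U d) = \sum_i weight U rho i * ln_riemann k 0 (d i).
Proof.
move=> k0 hU d0; apply: tr_ln_riemann_udiag => // j i; apply: lt0r_neq0;
  apply: ln_integrand_den_ge0; rewrite ?d0 //.
by rewrite ltr_pdivrMr ?ltr0n // mul1r ltr_nat addn0.
Qed.

End MatrixRiemannSums.

(** * Partial transposition and qubits *)

Section QubitFlip.
Variables (R : realType) (n : nat) (q : 'I_n -> bool) (x : 'I_n -> 'I_n).
Hypotheses (xK : involutive x) (qx : forall i, q (x i) = ~~ q i).
Implicit Types (A M psi : 'M[R[i]]_n) (v w : 'cV[R[i]]_n).

(* [q] reads the qubit off a basis index and [x] flips it. *)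
Definition block_part A : 'M[R[i]]_n := \matrix_(i, j) if q i == q j then A i j else 0.

Definition flip_mx A : 'M[R[i]]_n := \matrix_(i, j) A (x i) (x j).

Definition flip_col v : 'cV[R[i]]_n := \col_i v (x i) 0.

Definition restrict_col b v : 'cV[R[i]]_n := \col_i if q i == b then v i 0 else 0.

Lemma qf_flip A v : qf (flip_mx A) v = qf A (flip_col v).
Proof.
rewrite !qfE (reindex_inj (inv_inj xK)); apply: eq_bigr => i _.
by rewrite (reindex_inj (inv_inj xK)); apply: eq_bigr => j _; rewrite !mxE !xK.
Qed.

Lemma qf_block A v :
  qf (block_part A) v = qf A (restrict_col true v) + qf A (restrict_col false v).
Proof.
rewrite !qfE -big_split; apply: eq_bigr => i _; rewrite -big_split; apply: eq_bigr => j _.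
rewrite !mxE; case: (q i); case: (q j);
  by rewrite /= ?(rmorph0, mulr0, mul0r, addr0, add0r).
Qed.

(** Read [M] as the partial transpose of [psi] on the qubit: diagonal blocks stay and off-diagonal
    ones are swapped. Stating this through [q] and [x] covers both positions of the qubit. *)
Lemma flip_pd_bound (c : R) M psi v : pd psi ->
  (forall i j, M i j = if q i == q j then psi i j else psi (x i) (x j)) ->
  (forall w, qf M w <= qf (real_complex R c)%:M w) ->
  v != 0 -> 0 < qf M v + qf (real_complex R c)%:M v.
Proof.
move=> ppsi ME Mc v0; have /psdE[_ psi_ge0] := pd_psd ppsi.
have blockM : block_part M = block_part psi.
  by apply/matrixP => i j; rewrite !mxE ME; case: eqP.
(* Compressing [M <= c] to each value of the qubit bounds the block-diagonal part, which [M] and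
   [psi] share. *)
have block_le w : qf (block_part psi) w <= qf (real_complex R c)%:M w.
  have -> : (real_complex R c)%:M = block_part (real_complex R c)%:M.
    by apply/matrixP => i j; rewrite !mxE; case: eqVneq => [->|_]; rewrite ?eqxx // if_same.
  by rewrite -blockM !qf_block lerD.
(* The off-diagonal qubit blocks of [M] are those of [flip_mx psi]. *)
have key : M + flip_mx (block_part psi) = flip_mx psi + block_part psi.
  apply/matrixP => i j; rewrite !mxE ME !qx (inj_eq (can_inj negbK)).
  by case: eqP => _; rewrite ?addr0 // addrC.
have := congr1 (fun A => qf A v) key; rewrite !qfD !qf_flip => /(canRL (addrK _)) ->.
have := block_le (flip_col v); rewrite !qf_scalar.
have -> : \sum_i sqnormc (flip_col v i 0) = \sum_i sqnormc (v i 0).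
  by rewrite (reindex_inj (inv_inj xK)); apply: eq_bigr => i _; rewrite mxE xK.
have psi_gt0 : 0 < qf psi (flip_col v).
  apply: ppsi.2; apply: contra v0 => /eqP/matrixP h0; apply/eqP/matrixP => i j.
  by have := h0 (x i) j; rewrite !mxE xK ord1.
have block_ge0 : 0 <= qf (block_part psi) v by rewrite qf_block; exact: addr_ge0.
(* What is left is [psi] at the flipped vector, which is positive, plus two nonnegative terms: the
   block part at [v], and [c] minus the block part at the flipped vector. *)
move=> le_block; rewrite -addrA; apply: ltr_pwDl; first exact: ltr_pwDl.
by rewrite addrC subr_ge0.
Qed.

End QubitFlip.

(** * Partial transposition in tensor product coordinates *)

Section PartialTranspose.
Variables (R : realType) (n1 n2 : nat).
Implicit Types A B phi : 'M[R[i]]_(n1 * n2).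

Lemma ptransposeE A i1 i2 j1 j2 :
  ptranspose A (mxtens_index (i1, i2)) (mxtens_index (j1, j2)) =
  A (mxtens_index (i1, j2)) (mxtens_index (j1, i2)).
Proof. by rewrite mxE !mxtens_indexK. Qed.

Lemma mxtens_matrixP A B :
  (forall i1 i2 j1 j2, A (mxtens_index (i1, i2)) (mxtens_index (j1, j2)) =
                       B (mxtens_index (i1, i2)) (mxtens_index (j1, j2))) -> A = B.
Proof.
move=> h; apply/matrixP => i j.
by case: (mxtens_indexP i) => i1 i2; case: (mxtens_indexP j) => j1 j2.
Qed.

Lemma ptransposeK : involutive (@ptranspose R n1 n2).
Proof. by move=> A; apply: mxtens_matrixP => *; rewrite !ptransposeE. Qed.

Lemma ptransposeD A B : ptranspose (A + B) = ptranspose A + ptranspose B.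
Proof. by apply: mxtens_matrixP => *; rewrite ptransposeE [LHS]mxE [RHS]mxE !ptransposeE. Qed.

Lemma ptransposeZ (a : R[i]) A : ptranspose (a *: A) = a *: ptranspose A.
Proof. by apply: mxtens_matrixP => *; rewrite ptransposeE [LHS]mxE [RHS]mxE ptransposeE. Qed.

Lemma mxtens_index_eq (i1 j1 : 'I_n1) (i2 j2 : 'I_n2) :
  (mxtens_index (i1, i2) == mxtens_index (j1, j2)) = (i1 == j1) && (i2 == j2).
Proof. by rewrite (can_eq (@mxtens_indexK _ _)) xpair_eqE. Qed.

Lemma ptranspose_scalar (a : R[i]) :
  ptranspose (a%:M : 'M[R[i]]_(n1 * n2)) = a%:M.
Proof.
apply: mxtens_matrixP => i1 i2 j1 j2.
by rewrite ptransposeE [LHS]mxE [RHS]mxE !mxtens_index_eq (eq_sym j2).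
Qed.

Lemma ptranspose_adj A : (ptranspose A)^t* = ptranspose (A^t*).
Proof.
apply: mxtens_matrixP => *.
by rewrite ptransposeE [LHS]mxE [in LHS]mxE ptransposeE [RHS]mxE [in RHS]mxE.
Qed.

Lemma sum_mxtens (V : nmodType) (F : 'I_(n1 * n2) -> V) :
  \sum_i F i = \sum_i1 \sum_i2 F (mxtens_index (i1, i2)).
Proof.
rewrite pair_big /= (reindex (@mxtens_index n1 n2)) /=; last first.
  by exists (@mxtens_unindex n1 n2) => i _; rewrite (mxtens_indexK, mxtens_unindexK).
by apply: eq_bigr => -[].
Qed.

Lemma tr_ptranspose A : \tr (ptranspose A) = \tr A.
Proof.
by apply: eq_bigr => i _; case: (mxtens_indexP i) => i1 i2; rewrite ptransposeE.
Qed.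

(** Self-adjointness for the trace pairing amounts to exchanging the summation indices [i2] and
    [j2]. It moves the partial transposition from [tau] onto the gradient. *)
Lemma tr_mul_ptranspose A B : \tr (ptranspose A *m B) = \tr (A *m ptranspose B).
Proof.
have tr2 (X Y : 'M[R[i]]_(n1 * n2)) : \tr (X *m Y) = \sum_i1 \sum_j1 \sum_i2 \sum_j2
    X (mxtens_index (i1, i2)) (mxtens_index (j1, j2)) *
    Y (mxtens_index (j1, j2)) (mxtens_index (i1, i2)).
  rewrite /mxtrace sum_mxtens; apply: eq_bigr => i1 _; rewrite exchange_big /=.
  by apply: eq_bigr => i2 _; rewrite mxE sum_mxtens.
rewrite !tr2; apply: eq_bigr => i1 _; apply: eq_bigr => j1 _.
rewrite exchange_big; apply: eq_bigr => i2 _; apply: eq_bigr => j2 _.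
by rewrite !ptransposeE.
Qed.

End PartialTranspose.

Lemma rev_ord2 (a b : 'I_2) : a != b -> rev_ord a = b.
Proof. by case: a => -[|[|a]] // ?; case: b => -[|[|b]] // ? _; apply: val_inj. Qed.

Lemma rev_ord2_eq0 (a : 'I_2) : (rev_ord a == ord0) = ~~ (a == ord0).
Proof. by case: a => -[|[|a]]. Qed.

Lemma eq_ord2 (a b : 'I_2) : ((a == ord0) == (b == ord0)) = (a == b).
Proof. by case: a => -[|[|a]] // ?; case: b => -[|[|b]]. Qed.

Lemma pd_tr (R : realType) n (A : 'M[R[i]]_n) : pd A -> pd A^T.
Proof.
move=> [hA pA]; split; first by rewrite -[in RHS]hA; apply/matrixP => i j; rewrite !mxE.
move=> v v0; have -> : qf A^T v = qf A (map_mx Num.conj v).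
  rewrite !qfE exchange_big; apply: eq_bigr => i _; apply: eq_bigr => j _.
  by rewrite !mxE conjCK; congr (complex.Re _); ring.
apply: pA; apply: contra v0 => /eqP/matrixP h; apply/eqP/matrixP => i j.
by have := h i j; rewrite !mxE => /eqP; rewrite conjC_eq0 => /eqP.
Qed.

(** [ptranspose] acts on the second factor. If the qubit is the first one, the flip bound is applied
    to [phi^T], whose transpose on the first factor is again [ptranspose phi]. *)
Lemma ptranspose_pd_bound (R : realType) n1 n2 (c : R) (phi : 'M[R[i]]_(n1 * n2)) v :
  n1 = 2%N \/ n2 = 2%N -> pd phi ->
  (forall w, qf (ptranspose phi) w <= qf (real_complex R c)%:M w) ->
  v != 0 -> 0 < qf (ptranspose phi) v + qf (real_complex R c)%:M v.
Proof.
move=> [] h; subst=> pphi le_c v0.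
  pose q (k : 'I_(2 * n2)) := (mxtens_unindex k).1 == ord0.
  pose x (k : 'I_(2 * n2)) := mxtens_index (rev_ord (mxtens_unindex k).1, (mxtens_unindex k).2).
  have xE a b : x (mxtens_index (a, b)) = mxtens_index (rev_ord a, b).
    by rewrite /x mxtens_indexK.
  have qE a b : q (mxtens_index (a, b)) = (a == ord0) by rewrite /q mxtens_indexK.
  apply: (@flip_pd_bound _ _ q x _ _ c _ phi^T) => //; last 1 first.
  - move=> i j; case: (mxtens_indexP i) => i1 i2; case: (mxtens_indexP j) => j1 j2.
    rewrite ptransposeE !xE !qE eq_ord2 ![phi^T _ _]mxE; case: eqVneq => [->|] // ij.
    by rewrite (rev_ord2 ij); rewrite eq_sym in ij; rewrite (rev_ord2 ij).
  - by move=> i; case: (mxtens_indexP i) => i1 i2; rewrite !xE rev_ordK.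
  - by move=> i; case: (mxtens_indexP i) => i1 i2; rewrite xE !qE rev_ord2_eq0.
  - exact: pd_tr.
pose q (k : 'I_(n1 * 2)) := (mxtens_unindex k).2 == ord0.
pose x (k : 'I_(n1 * 2)) := mxtens_index ((mxtens_unindex k).1, rev_ord (mxtens_unindex k).2).
have xE a b : x (mxtens_index (a, b)) = mxtens_index (a, rev_ord b).
  by rewrite /x mxtens_indexK.
have qE a b : q (mxtens_index (a, b)) = (b == ord0) by rewrite /q mxtens_indexK.
apply: (@flip_pd_bound _ _ q x _ _ c _ phi) => //; last 1 first.
- move=> i j; case: (mxtens_indexP i) => i1 i2; case: (mxtens_indexP j) => j1 j2.
  rewrite ptransposeE !xE !qE eq_ord2; case: eqVneq => [->|] // ij.
  by rewrite (rev_ord2 ij); rewrite eq_sym in ij; rewrite (rev_ord2 ij).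
- by move=> i; case: (mxtens_indexP i) => i1 i2; rewrite !xE rev_ordK.
- by move=> i; case: (mxtens_indexP i) => i1 i2; rewrite xE !qE rev_ord2_eq0.
Qed.

(** * Continuity and compactness *)

Lemma subl_continuous_at (R : realType) (T : topologicalType) (p : T) (a : R) (f : T -> R) :
  {for p, continuous f} -> {for p, continuous (fun x => a - f x)}.
Proof. by move=> cf; apply: cvgB => //; exact: cvg_cst. Qed.

Section Attainment.
Variables (R : realType) (T : topologicalType) (K : set T).
Hypothesis Kcompact : compact K.

(** Lower semicontinuity is phrased as closedness of the sublevel sets relative to [K]. The sublevel
    sets at finite values of [f] are nested and generate a proper filter; a cluster point lies in
    all of them. *)
Lemma lsc_attains_min (f : T -> \bar R) : K !=set0 -> (forall p, f p != -oo%E) ->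
  (forall (y : R) p, K p -> closure (K `&` [set x | (f x <= y%:E)%E]) p -> (f p <= y%:E)%E) ->
  exists2 p, K p & forall q, K q -> (f p <= f q)%E.
Proof.
move=> [p0 Kp0] fNy flsc.
(* If [f] is [+oo] on all of [K], any point is a minimizer. *)
have [[q0 [Kq0 q0y]]|noq] := pselect (exists q, K q /\ f q != +oo%E); last first.
  exists p0 => // q Kq; suff -> : f q = +oo%E by exact: leey.
  by apply: contra_notP noq => /eqP; exists q.
pose D q := K `&` [set p | (f p <= f q)%E].
pose F := filter_from [set q | K q /\ f q != +oo%E] D.
have FF : ProperFilter F.
  apply: filter_from_proper; last by move=> q [Kq _]; exists q; split => //=.
  apply: filter_from_filter; first by exists q0.
  move=> a b [Ka ya] [Kb yb]; have [ab|ba] := leP (f a) (f b).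
    by exists a => // p [Kp pa]; split; split => //; exact: le_trans pa ab.
  by exists b => // p [Kp pb]; split; split => //; exact: le_trans pb (ltW ba).
have FK : F K by exists q0 => // p [].
have [p [Kp clp]] := Kcompact FF FK.
exists p => // q Kq; have [->|yq] := eqVneq (f q) +oo%E; first exact: leey.
have fq : f q \is a fin_num by rewrite fin_numE fNy yq.
rewrite -(fineK fq); apply: flsc => // B nB; apply: clp => //; exists q => //.
by rewrite /D (fineK fq).
Qed.

Lemma closure_sublevel (f : T -> R) (y : R) p : {for p, continuous f} ->
  closure (K `&` [set x | f x <= y]) p -> f p <= y.
Proof.
move=> fc clp; rewrite leNgt; apply/negP => yp.
have [|q [[_ /= qy] /=]] := clp (f @^-1` [set z | y < z]).
  by apply: fc; apply: open_nbhs_nbhs; split => //; exact: open_gt.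
by rewrite ltNge qy.
Qed.

Lemma continuous_attains_max (f : T -> R) : K !=set0 ->
  (forall p, K p -> {for p, continuous f}) ->
  exists2 p, K p & forall q, K q -> f q <= f p.
Proof.
move=> K0 cf; have [//|//||p Kp pmin] := @lsc_attains_min (fun x => (0 - f x)%:E).
  move=> y p Kp; rewrite lee_fin; apply: closure_sublevel.
  by apply: subl_continuous_at; exact: cf.
by exists p => // q /pmin; rewrite lee_fin !sub0r lerN2.
Qed.

End Attainment.

(** * Continuity of complex matrix expressions *)

Section ComplexContinuity.
Variables (R : realType) (T : topologicalType) (p : T).
Implicit Types F G : T -> R[i].

(** Continuity at [p] is tested on the two real components, so that only the topology of [R] is
    involved. *)
Definition ccont F : Prop :=
  {for p, continuous (fun x => complex.Re (F x))} /\
  {for p, continuous (fun x => complex.Im (F x))}.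

Lemma ccont_cst (z : R[i]) : ccont (fun=> z).
Proof. by split; exact: cvg_cst. Qed.

Lemma ccontD F G : ccont F -> ccont G -> ccont (fun x => F x + G x).
Proof.
move=> [Fr Fi] [Gr Gi]; split; rewrite /prop_for /continuous_at.
- by under eq_fun do rewrite RecD; rewrite RecD; exact: cvgD.
- by under eq_fun do rewrite ImcD; rewrite ImcD; exact: cvgD.
Qed.

Lemma ccontN F : ccont F -> ccont (fun x => - F x).
Proof.
move=> [Fr Fi]; split; rewrite /prop_for /continuous_at.
- by under eq_fun do rewrite RecN; rewrite RecN; exact: cvgN.
- by under eq_fun do rewrite ImcN; rewrite ImcN; exact: cvgN.
Qed.

Lemma ccont_conj F : ccont F -> ccont (fun x => (F x)^*).
Proof.
move=> [Fr Fi]; split; rewrite /prop_for /continuous_at.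
- by under eq_fun do rewrite Rec_conj; rewrite Rec_conj.
- by under eq_fun do rewrite Imc_conj; rewrite Imc_conj; exact: cvgN.
Qed.

Lemma ccontM F G : ccont F -> ccont G -> ccont (fun x => F x * G x).
Proof.
move=> [Fr Fi] [Gr Gi]; split; rewrite /prop_for /continuous_at.
- by under eq_fun do rewrite RecM; rewrite RecM; apply: cvgB; exact: cvgM.
- by under eq_fun do rewrite ImcM; rewrite ImcM; apply: cvgD; exact: cvgM.
Qed.

Lemma ccontV F : F p != 0 -> ccont F -> ccont (fun x => (F x)^-1).
Proof.
move=> Fp [Fr Fi].
have ReV (z : R[i]) : complex.Re z^-1 = complex.Re z / sqnormc z by case: z.
have ImV (z : R[i]) : complex.Im z^-1 = - complex.Im z / sqnormc z by case: z => a b;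
  rewrite /= mulNr.
have nF : (fun x => sqnormc (F x)) @ p --> sqnormc (F p).
  by apply: cvgD; apply: cvgM.
have n0 : sqnormc (F p) != 0 by apply: contra Fp => /eqP /sqnormc_eq0 ->.
split; rewrite /prop_for /continuous_at.
- by under eq_fun do rewrite ReV; rewrite ReV; apply: cvgM => //; exact: cvgV.
- under eq_fun do rewrite ImV; rewrite ImV; apply: cvgM; first exact: cvgN.
  exact: cvgV.
Qed.

Lemma ccont_sum (I : Type) (r : seq I) (P : pred I) (F : I -> T -> R[i]) :
  (forall k, ccont (F k)) -> ccont (fun x => \sum_(k <- r | P k) F k x).
Proof.
move=> h; elim: r => [|k r IH].
  by under eq_fun do rewrite big_nil; exact: ccont_cst.
under eq_fun do rewrite big_cons; case: (P k) => //.
exact: ccontD.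
Qed.

Lemma ccont_prod (I : Type) (r : seq I) (P : pred I) (F : I -> T -> R[i]) :
  (forall k, ccont (F k)) -> ccont (fun x => \prod_(k <- r | P k) F k x).
Proof.
move=> h; elim: r => [|k r IH].
  by under eq_fun do rewrite big_nil; exact: ccont_cst.
under eq_fun do rewrite big_cons; case: (P k) => //.
exact: ccontM.
Qed.

Definition mcont m n (M : T -> 'M[R[i]]_(m, n)) : Prop :=
  forall i j, ccont (fun x => M x i j).

Lemma mcont_cst m n (A : 'M[R[i]]_(m, n)) : mcont (fun=> A).
Proof. by move=> i j; exact: ccont_cst. Qed.

Lemma mcontD m n (M N : T -> 'M[R[i]]_(m, n)) :
  mcont M -> mcont N -> mcont (fun x => M x + N x).
Proof. by move=> hM hN i j; under eq_fun do rewrite mxE; exact: ccontD. Qed.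

Lemma mcontN m n (M : T -> 'M[R[i]]_(m, n)) : mcont M -> mcont (fun x => - M x).
Proof. by move=> hM i j; under eq_fun do rewrite mxE; exact: ccontN. Qed.

Lemma mcontZ m n (a : T -> R[i]) (M : T -> 'M[R[i]]_(m, n)) :
  ccont a -> mcont M -> mcont (fun x => a x *: M x).
Proof. by move=> ha hM i j; under eq_fun do rewrite mxE; exact: ccontM. Qed.

Lemma mcontM m n q (M : T -> 'M[R[i]]_(m, n)) (N : T -> 'M[R[i]]_(n, q)) :
  mcont M -> mcont N -> mcont (fun x => M x *m N x).
Proof.
move=> hM hN i j; under eq_fun do rewrite mxE.
by apply: ccont_sum => k; exact: ccontM.
Qed.

Lemma ccont_tr n (M : T -> 'M[R[i]]_n) : mcont M -> ccont (fun x => \tr (M x)).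
Proof. by move=> hM; apply: ccont_sum => k. Qed.

Lemma ccont_det n (M : T -> 'M[R[i]]_n) : mcont M -> ccont (fun x => \det (M x)).
Proof.
move=> hM; apply: ccont_sum => s; apply: ccontM; first exact: ccont_cst.
by apply: ccont_prod => k.
Qed.

Lemma mcont_adj n (M : T -> 'M[R[i]]_n) : mcont M -> mcont (fun x => \adj (M x)).
Proof.
move=> hM i j; under eq_fun do rewrite mxE; apply: ccontM; first exact: ccont_cst.
by apply: ccont_det => k l; under eq_fun do rewrite !mxE.
Qed.

(** [invmx] follows Cramer's rule only on invertible matrices; [M x] is one for [x] near [p], by
    continuity of the determinant. *)
Lemma mcont_inv n (M : T -> 'M[R[i]]_n) : M p \in unitmx -> mcont M ->
  mcont (fun x => invmx (M x)).
Proof.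
move=> uM hM.
pose J x := (\det (M x))^-1 *: \adj (M x).
have hJ : mcont J.
  apply: mcontZ; last exact: mcont_adj.
  by apply: ccontV; [rewrite -unitfE | exact: ccont_det].
have Jp : J p = invmx (M p) by rewrite /J /invmx uM.
have near_J : \forall x \near p, M x \in unitmx.
  have [dr di] := ccont_det hM.
  have nd : (fun x => sqnormc (\det (M x))) @ p --> sqnormc (\det (M p)).
    by apply: cvgD; apply: cvgM.
  have d0 : 0 < sqnormc (\det (M p)).
    rewrite lt_neqAle sqnormc_ge0 andbT eq_sym; apply/eqP => /sqnormc_eq0 h.
    by move: uM; rewrite unitmxE h unitr0.
  have nb : nbhs (sqnormc (\det (M p))) [set z : R | 0 < z].
    by apply: open_nbhs_nbhs; split => //; exact: open_gt.
  have near_d : nbhs p [set x | 0 < sqnormc (\det (M x))] := nd _ nb.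
  apply: (filterS _ near_d) => x /= h; rewrite unitmxE unitfE; apply: contraTneq h => ->.
  by rewrite /sqnormc /= expr0n addr0 ltxx.
have near_eq i j : \forall x \near p, J x i j = invmx (M x) i j.
  by apply: (filterS _ near_J) => x ux; rewrite /J /invmx ux.
move=> i j; have [Jr Ji] := hJ i j.
split; rewrite /prop_for /continuous_at -Jp.
- apply: cvg_trans Jr; apply: near_eq_cvg.
  by apply: (filterS _ (near_eq i j)) => x ->.
- apply: cvg_trans Ji; apply: near_eq_cvg.
  by apply: (filterS _ (near_eq i j)) => x ->.
Qed.

End ComplexContinuity.

(** * Entry bounds for positive semidefinite matrices *)

Section EntryBounds.
Variables (R : realType) (n : nat).
Implicit Types (A : 'M[R[i]]_n).

Lemma sesqui_delta A i j : ((delta_mx i 0 : 'cV[R[i]]_n)^t* *m A *m (delta_mx j 0 :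
  'cV[R[i]]_n)) 0 0 = A i j.
Proof.
have -> : (delta_mx i 0 : 'cV[R[i]]_n)^t* = delta_mx 0 i.
  by apply/matrixP => a b; rewrite !mxE andbC; case: (_ && _); rewrite ?rmorph1 ?rmorph0.
by rewrite -rowE -colE !mxE.
Qed.

Lemma qf_delta2 A i j (z : R[i]) :
  qf A (delta_mx i 0 + z *: delta_mx j 0) =
  complex.Re (A i i + z * A i j + z^* * A j i + z^* * z * A j j).
Proof.
have mxD (X Y : 'M[R[i]]_1) : (X + Y) 0 0 = X 0 0 + Y 0 0 by rewrite mxE.
have mxZ a (X : 'M[R[i]]_1) : (a *: X) 0 0 = a * X 0 0 by rewrite mxE.
have expand (u u' : 'rV[R[i]]_n) (w w' : 'cV[R[i]]_n) (a b : R[i]) :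
    ((u + a *: u') *m A *m (w + b *: w')) 0 0 = (u *m A *m w) 0 0 + b * (u *m A *m w') 0 0 +
      a * (u' *m A *m w) 0 0 + a * b * (u' *m A *m w') 0 0.
  rewrite mulmxDr !mulmxDl -!scalemxAl -!scalemxAr !(mxD, mxZ); ring.
rewrite /qf.
have -> : (delta_mx i 0 + z *: delta_mx j 0 : 'cV[R[i]]_n)^t* =
    (delta_mx i 0 : 'cV[R[i]]_n)^t* + z^* *: (delta_mx j 0 : 'cV[R[i]]_n)^t*.
  by apply/matrixP => a b; rewrite !mxE rmorphD rmorphM.
by rewrite expand !sesqui_delta.
Qed.

Lemma psd_diag_ge0 A i : psd A -> 0 <= complex.Re (A i i).
Proof.
move=> /psdE[_ /(_ (delta_mx i 0 + 0 *: delta_mx i 0))].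
by rewrite qf_delta2 rmorph0 !mul0r !addr0.
Qed.

Lemma psd_tr_ge0 A : psd A -> 0 <= complex.Re (\tr A).
Proof. by move=> pA; rewrite /mxtrace Rec_sum sumr_ge0 // => i _; exact: psd_diag_ge0. Qed.

Lemma psd_diag_le_tr A i : psd A -> complex.Re (A i i) <= complex.Re (\tr A).
Proof.
move=> pA; rewrite /mxtrace Rec_sum (bigD1 i) //= lerDl sumr_ge0 // => j _.
exact: psd_diag_ge0.
Qed.

(** Testing positivity on [e_i + z e_j], with [z] among the fourth roots of unity, bounds twice the
    real and imaginary parts by the sum of two diagonal entries. *)
Lemma psd_entry_le_tr A i j : psd A ->
  `|complex.Re (A i j)| <= complex.Re (\tr A) /\ `|complex.Im (A i j)| <= complex.Re (\tr A).
Proof.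
move=> pA; have /psdE[hA qA] := pA.
have hij : A j i = (A i j)^* by rewrite -[in LHS]hA !mxE.
have h z := qA (delta_mx i 0 + z *: delta_mx j 0).
have {}h z : 0 <= complex.Re (A i i + z * A i j + z^* * (A i j)^* + z^* * z * A j j).
  by rewrite -hij -qf_delta2; exact: h.
have := h 1; have := h (-1); have := h (Complex 0 1); have := h (Complex 0 (-1)).
have := psd_diag_le_tr i pA; have := psd_diag_le_tr j pA.
case: (A i j) => x y; case: (A i i) => a b; case: (A j j) => c d.
case: (\tr A) => t u /=; rewrite /Num.conj /= !ler_norml.
rewrite !(mul0r, mul1r, mulr0, mulN1r, mulr1, add0r, addr0, subr0, oppr0, opprK, sub0r, mulrN,
  mulNr).
move=> ? ? ? ? ? ?; split; apply/andP; split; lra.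
Qed.

End EntryBounds.

(** * Pairs of matrices as points of a product space *)

Section Coordinates.
Variables (R : realType) (n : nat).

(* Coordinates of a pair of complex matrices: the first boolean selects the matrix, the
   second one the real (false) or the imaginary (true) part. *)
Definition coord_index : eqType := (bool * bool * ('I_n * 'I_n))%type.

(** The product topology makes the coordinates continuous and boxes compact, by Tychonoff. *)
Definition coords : topologicalType := {ptws coord_index -> R}.

Definition mx_of_coords (b : bool) (x : coords) : 'M[R[i]]_n :=
  \matrix_(i, j) Complex (x (b, false, (i, j))) (x (b, true, (i, j))).

Definition coords_of_mx (A B : 'M[R[i]]_n) : coords := fun k =>
  let: (b, c, (i, j)) := k in
  let z := (if b then A else B) i j in if c then complex.Im z else complex.Re z.

Definition unit_box : set coords := [set x | forall k, `[-1, 1]%classic (x k)].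

Lemma coords_of_mxK b A B : mx_of_coords b (coords_of_mx A B) = if b then A else B.
Proof. by apply/matrixP => i j; rewrite mxE /=; case: (_ i j). Qed.

Lemma mcont_mx_of_coords b p : mcont p (mx_of_coords b).
Proof.
move=> i j; split; rewrite /prop_for /continuous_at.
- under eq_fun do rewrite mxE /=; rewrite mxE /=.
  exact: (@proj_continuous coord_index (fun=> R) (b, false, (i, j))).
- under eq_fun do rewrite mxE /=; rewrite mxE /=.
  exact: (@proj_continuous coord_index (fun=> R) (b, true, (i, j))).
Qed.

Lemma unit_box_compact : compact unit_box.
Proof.
exact: (@tychonoff coord_index (fun=> R : topologicalType) (fun=> [set` `[-1, 1]%R])
  (fun=> @segment_compact R (-1) 1)).
Qed.

Lemma unit_box_coords_of_mx A B : psd A -> complex.Re (\tr A) <= 1 ->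
  psd B -> complex.Re (\tr B) <= 1 -> unit_box (coords_of_mx A B).
Proof.
move=> pA tA pB tB [[b c] [i j]]; rewrite /= in_itv /= -ler_norml.
have [A1 A2] := psd_entry_le_tr i j pA; have [B1 B2] := psd_entry_le_tr i j pB.
by case: b; case: c; rewrite /=; [apply: le_trans A2 _ | apply: le_trans A1 _
  | apply: le_trans B2 _ | apply: le_trans B1 _].
Qed.

End Coordinates.

(** * Closed conditions on matrices *)

Section ClosedConstraints.
Variables (R : realType) (T : topologicalType).

Lemma closed_forall (I : Type) (A : I -> set T) :
  (forall k, closed (A k)) -> closed [set x | forall k, A k x].
Proof.
move=> cA p clp k; apply: cA; apply: closure_subset clp => x; exact.
Qed.

Lemma closed_le_cst (f : T -> R) (y : R) : continuous f -> closed [set x | f x <= y].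
Proof. by move=> cf; apply: (@preimage_closed _ _ f [set z | z <= y]) => //; exact: closed_le. Qed.

Lemma closed_ge_cst (f : T -> R) (y : R) : continuous f -> closed [set x | y <= f x].
Proof. by move=> cf; apply: (@preimage_closed _ _ f [set z | y <= z]) => //; exact: closed_ge. Qed.

Lemma closed_ccont_eq (F : T -> R[i]) (z : R[i]) : (forall p, ccont p F) ->
  closed [set x | F x = z].
Proof.
move=> cF.
have -> : [set x | F x = z] =
    [set x | complex.Re (F x) <= complex.Re z] `&` [set x | complex.Re z <= complex.Re (F x)] `&`
    ([set x | complex.Im (F x) <= complex.Im z] `&` [set x | complex.Im z <= complex.Im (F x)]).
  apply/seteqP; split => x /=; first by move=> ->; rewrite !lexx.
  move=> [[h1 h2] [h3 h4]]; case: (F x) h1 h2 h3 h4 => a b; case: (z) => c d /= h1 h2 h3 h4.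
  by congr Complex; apply: le_anti; rewrite ?h1 ?h3.
have cR : continuous (fun x => complex.Re (F x)) by move=> p; have [] := cF p.
have cI : continuous (fun x => complex.Im (F x)) by move=> p; have [] := cF p.
by apply: closedI; apply: closedI; (exact: closed_le_cst || exact: closed_ge_cst).
Qed.

(** Hermiticity of each entry and nonnegativity at each vector are closed conditions, and closed
    sets are stable under arbitrary intersections. *)
Lemma closed_psd n (M : T -> 'M[R[i]]_n) : (forall p, mcont p M) -> closed [set x | psd (M x)].
Proof.
move=> cM.
have -> : [set x | psd (M x)] =
    [set x | forall ij : 'I_n * 'I_n, (M x ij.2 ij.1)^* - M x ij.1 ij.2 = 0] `&`
    [set x | forall v, 0 <= qf (M x) v].
  apply/seteqP; split => x /=.
    move=> /psdE[hM qM]; split => // ij.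
    by have /matrixP/(_ ij.1 ij.2) := hM; rewrite !mxE => ->; rewrite subrr.
  move=> [hM qM]; apply/psdE; split => //; apply/matrixP => i j.
  by rewrite !mxE; apply/eqP; rewrite -subr_eq0 (hM (i, j)).
apply: closedI; apply: closed_forall => k.
  apply: closed_ccont_eq => p; apply: ccontD; [exact/ccont_conj/cM | exact/ccontN/cM].
apply: closed_ge_cst => p.
have : mcont p (fun x => k^t* *m M x *m k).
  apply: mcontM; last exact: mcont_cst.
  by apply: mcontM; [exact: mcont_cst | exact: cM].
by move=> /(_ 0 0) [].
Qed.

End ClosedConstraints.

(** * Relative entropy *)

Section RelativeEntropy.
Variables (R : realType) (n : nat).
Implicit Types (rho sigma U : 'M[R[i]]_n) (d : 'I_n -> R).

Definition ln_supp (t : R) : R := if 0 < t then ln t else 0.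

Definition neg_entropy rho : R := complex.Re (\tr (rho *m logmx rho)).

Lemma relative_entropy_udiag rho U d : psd rho -> U \is unitarymx ->
  relative_entropy rho (udiag U d) =
  if `[< forall i, d i = 0 -> weight U rho i = 0 >]
  then (neg_entropy rho - \sum_i weight U rho i * ln_supp (d i))%:E else +oo%E.
Proof.
move=> prho hU; rewrite /relative_entropy.
rewrite (asbool_equiv_eq (kernel_sub_udiag d prho hU)); case: asboolP => // _.
by rewrite mulmxBr mxtraceB RecB -Re_tr_udiag {2}/logmx mxfun_udiag.
Qed.

Lemma udiag_sum U d : U \is unitarymx -> \sum_i d i = complex.Re (\tr (udiag U d)).
Proof. by move=> hU; rewrite -(weight_sum _ hU); apply: eq_bigr => i _; rewrite weight_udiag. Qed.

Lemma eigen_le1 U d i : U \is unitarymx -> (forall j, 0 <= d j) ->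
  complex.Re (\tr (udiag U d)) <= 1 -> d i <= 1.
Proof.
move=> hU d0; rewrite -udiag_sum // (bigD1 i) //=; apply: le_trans.
by rewrite lerDl sumr_ge0.
Qed.

Lemma le_archi (a b c : R) : (forall k, (0 < k)%N -> a <= b + c / k%:R) -> a <= b.
Proof.
move=> h; rewrite leNgt; apply/negP => ba.
have ab0 : 0 < a - b by rewrite subr_gt0.
have [k kc] : exists k : nat, `|c| / (a - b) < k%:R.
  by exists (Num.truncn (`|c| / (a - b))).+1; rewrite truncnS_gt.
have k0 : (0 < k)%N.
  by rewrite -(ltr0n R); apply: le_lt_trans kc; rewrite divr_ge0 // ltW.
have := h k k0; rewrite leNgt -ltrBrDl.
have -> // : c / k%:R < a - b.
apply: (@le_lt_trans _ _ (`|c| / k%:R)).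
  by rewrite ler_pM2r ?invr_gt0 ?ltr0n // ler_norm.
by rewrite ltr_pdivrMr ?ltr0n // mulrC -ltr_pdivrMr.
Qed.

(** Exhibits the relative entropy as a supremum over [k] of expressions continuous in the second
    argument. Left sums dominate [ln], which gives one direction. For the converse, eigenvalues are
    raised to a floor [e > 0], [k] tends to infinity, and [e] is chosen afterwards. *)
Lemma relative_entropy_le_udiag rho U d (y : R) : psd rho -> U \is unitarymx ->
  (forall i, 0 <= d i <= 1) ->
  (relative_entropy rho (udiag U d) <= y%:E)%E <->
  forall k, (0 < k)%N -> neg_entropy rho - tr_ln_riemann rho k 0 (udiag U d) <= y.
Proof.
move=> prho hU d01; rewrite relative_entropy_udiag //.
have d0 i : 0 <= d i by have /andP[] := d01 i.
have d1 i : d i <= 1 by have /andP[] := d01 i.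
have w0 i : 0 <= weight U rho i by exact: weight_ge0.
set w := weight U rho in w0 *; set H := neg_entropy rho.
have tr_ln_riemannE k : (0 < k)%N ->
  tr_ln_riemann rho k 0 (udiag U d) = \sum_i w i * ln_riemann k 0 (d i).
  by move=> k0; rewrite tr_ln_riemann0_udiag.
split.
  case: asboolP => // hw; rewrite lee_fin => hy k k0; apply: le_trans hy.
  rewrite lerD2l lerN2 tr_ln_riemannE //; apply: ler_sum => i _.
  have [di|di] := eqVneq (d i) 0; first by rewrite hw // !mul0r.
  have {}di : 0 < d i by rewrite lt_neqAle eq_sym di d0.
  by rewrite ler_wpM2l // /ln_supp di ln_le_ln_riemann0.
move=> hk.
(* Above the floor [e] the left sums exceed [ln] by at most [1 / (k e)], which vanishes as [k]
   grows. *)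
have key (e : R) : 0 < e -> e <= 1 -> H - \sum_i w i * ln (Num.max (d i) e) <= y.
  move=> e0 e1; apply: (@le_archi _ _ (\sum_i w i * e^-1)) => k k0.
  rewrite -lerBlDr; apply: le_trans (hk k k0); rewrite tr_ln_riemannE // -addrA lerD2l -opprD lerN2.
  rewrite mulr_suml -big_split /=; apply: ler_sum => i _.
  rewrite -mulrA -mulrDr ler_wpM2l //.
  have dm : d i <= Num.max (d i) e by rewrite le_max lexx.
  apply: (le_trans (le_ln_riemann0 k0 (d0 i) dm)).
  have m0 : 0 < Num.max (d i) e by rewrite lt_max e0 orbT.
  have m1 : Num.max (d i) e <= 1 by rewrite ge_max d1.
  apply: (le_trans (ln_riemann0_le_ln k0 m0 m1)).
  rewrite lerD2l invfM mulrC ler_wpM2r ?invr_ge0 ?ler0n //.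
  by rewrite lef_pV2 ?posrE // le_max lexx orbT.
have ln_max_le0 i (e : R) : e <= 1 -> ln (Num.max (d i) e) <= 0.
  by move=> e1; rewrite ln_le0 // ge_max d1.
have hw i : d i = 0 -> w i = 0.
  move=> di; apply/eqP; rewrite eq_le w0 andbT leNgt; apply/negP => wi.
  (* With the floor [expR (- t)], a positive weight on a zero eigenvalue contributes
     [w i * t >= y - H + 1], against [key]. *)
  pose t := Num.max 0 ((y - H + 1) / w i).
  have t0 : 0 <= t by rewrite le_max lexx.
  have := key (expR (- t)) (expR_gt0 _); rewrite -expR0 ler_expR oppr_le0 => /(_ t0).
  apply/negP; rewrite -ltNge.
  have : - \sum_j w j * ln (Num.max (d j) (expR (- t))) >= w i * t.
    rewrite (bigD1 i) //= opprD di max_r ?expR_ge0 // expRK mulrN opprK.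
    rewrite lerDl oppr_ge0 sumr_le0 // => j _; rewrite mulr_ge0_le0 //.
    by apply: ln_max_le0; rewrite -expR0 ler_expR oppr_le0.
  have : w i * t >= y - H + 1.
    by rewrite mulrC -ler_pdivrMr // le_max lexx orbT.
  by lra.
rewrite asboolT // lee_fin.
(* A floor not exceeding any positive eigenvalue leaves these unchanged, and the zero ones carry no
   weight. *)
pose e := \big[Order.min/(1 : R)]_(i | 0 < d i) d i.
have e0 : 0 < e by apply: lt_bigmin.
have e1 : e <= 1 by exact: bigmin_le_id.
apply: le_trans (key e e0 e1); rewrite lerD2l lerN2; apply: ler_sum => i _.
have [di|di] := eqVneq (d i) 0; first by rewrite hw // !mul0r.
have {}di : 0 < d i by rewrite lt_neqAle eq_sym di d0.
by rewrite max_l ?/ln_supp ?di //; exact: bigmin_le_cond.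
Qed.

Lemma relative_entropy_le rho sigma (y : R) : psd rho -> psd sigma ->
  complex.Re (\tr sigma) <= 1 ->
  (relative_entropy rho sigma <= y%:E)%E <->
  forall k, (0 < k)%N -> neg_entropy rho - tr_ln_riemann rho k 0 sigma <= y.
Proof.
move=> prho /psd_udiag[U [d [hU -> d0]]] tr1; apply: relative_entropy_le_udiag => // i.
by rewrite d0 (@eigen_le1 U).
Qed.

Lemma ln_denom_mx_unit U d (u : R) : U \is unitarymx -> (forall i, 0 < 1 + u * (d i - 1)) ->
  ln_denom_mx u (udiag U d) \in unitmx.
Proof. by move=> hU h; rewrite ln_denom_mx_udiag //; apply/pd_unit/udiag_pd. Qed.

Lemma ln_denom_mx0_unit sigma k (j : 'I_k) : psd sigma ->
  ln_denom_mx ((j + 0)%:R / k%:R) sigma \in unitmx.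
Proof.
move=> /psd_udiag[U [d [hU -> d0]]]; apply: ln_denom_mx_unit => // i.
have k0 : (0 < k)%N by case: k j => [[]|].
by apply: ln_integrand_den_ge0 => //; rewrite addn0 ltr_pdivrMr ?ltr0n // mul1r ltr_nat.
Qed.

Lemma pd_udiag sigma : pd sigma ->
  exists U d, [/\ U \is unitarymx, sigma = udiag U d & forall i, 0 < d i].
Proof.
move=> ps; have /psd_udiag[U [d [hU sE d0]]] := pd_psd ps.
exists U, d; split => // i; rewrite -(weight_udiag d i hU) -sE; exact: pd_weight_gt0.
Qed.

Lemma ln_denom_mx1_unit sigma k (j : 'I_k) : pd sigma ->
  ln_denom_mx ((j + 1)%:R / k%:R) sigma \in unitmx.
Proof.
move=> /pd_udiag[U [d [hU -> d0]]]; apply: ln_denom_mx_unit => // i.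
have k0 : (0 < k)%N by case: k j => [[]|].
by apply: ln_integrand_den_gt0 => //; rewrite ler_pdivrMr ?ltr0n // mul1r ler_nat addn1.
Qed.

Lemma mcont_ln_denom_mx (T : topologicalType) (p : T) (M : T -> 'M[R[i]]_n) u :
  mcont p M -> mcont p (fun x => ln_denom_mx u (M x)).
Proof.
move=> hM; apply: mcontD; first exact: mcont_cst.
apply: mcontZ; first exact: ccont_cst.
by apply: mcontD => //; exact: mcont_cst.
Qed.

Lemma tr_ln_riemann_continuous (T : topologicalType) (p : T) (M : T -> 'M[R[i]]_n) rho k b :
  mcont p M -> (forall j : 'I_k, ln_denom_mx ((j + b)%:R / k%:R) (M p) \in unitmx) ->
  {for p, continuous (fun x => tr_ln_riemann rho k b (M x))}.
Proof.
move=> hM hu.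
have : ccont p (fun x => real_complex R k%:R^-1 *
    \sum_(j < k) \tr (rho *m ln_integrand_mx ((j + b)%:R / k%:R) (M x))).
  apply: ccontM; first exact: ccont_cst.
  apply: ccont_sum => j; apply: ccont_tr; apply: mcontM; first exact: mcont_cst.
  apply: mcontM; first by apply: mcontD => //; exact: mcont_cst.
  by apply: mcont_inv => //; exact: mcont_ln_denom_mx.
case=> + _; rewrite /prop_for /continuous_at.
by under eq_fun do rewrite RecZ Rec_sum; rewrite RecZ Rec_sum.
Qed.

End RelativeEntropy.

(** * Existence of a closest PPT state *)

Section Minimum.
Variables (R : realType) (n1 n2 : nat).
Implicit Types rho sigma : 'M[R[i]]_(n1 * n2).

Lemma ppt_min rho : is_state rho -> (exists sigma, @is_ppt_state R n1 n2 sigma) ->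
  exists2 sigma, is_ppt_state sigma & forall sigma', is_ppt_state sigma' ->
    (relative_entropy rho sigma <= relative_entropy rho sigma')%E.
Proof.
move=> [prho trho] [sigma0 ppt0].
(* A single matrix is encoded as a pair with second component [0]. *)
have [X cX Xenc] : exists2 X : coords R (n1 * n2)%N -> 'M[R[i]]_(n1 * n2),
    forall p, mcont p X & forall sigma, X (coords_of_mx sigma 0) = sigma.
  exists (mx_of_coords true); first exact: mcont_mx_of_coords.
  by move=> sigma; exact: coords_of_mxK.
have cGX p : mcont p (fun x => ptranspose (X x)).
  by move=> i j; under eq_fun do rewrite mxE; exact: cX.
pose K := @unit_box R (n1 * n2)%N `&` [set x | is_ppt_state (X x)].
have clK : closed [set x | is_ppt_state (X x)].
  have -> : [set x | is_ppt_state (X x)] =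
      [set x | psd (X x)] `&` [set x | \tr (X x) = 1] `&` [set x | psd (ptranspose (X x))].
    by apply/seteqP; split => x [[a b] c]; exact: (conj (conj a b) c).
  apply: closedI; last exact: closed_psd.
  apply: closedI; first exact: closed_psd.
  by apply: closed_ccont_eq => p; apply: ccont_tr.
have cK : compact K by apply: compact_closedI => //; exact: unit_box_compact.
have Kenc sigma : is_ppt_state sigma -> K (coords_of_mx sigma 0).
  move=> ppt; split; last by move=> /=; rewrite Xenc.
  have [[ps ts] _] := ppt.
  apply: (unit_box_coords_of_mx ps _ (psd0 R _)); first by rewrite ts.
  by rewrite mxtrace0 ler01.
have [|||p [_ pK] pmin] := @lsc_attains_min _ _ K cK (fun x => relative_entropy rho (X x)).
- by exists (coords_of_mx sigma0 0); exact: Kenc.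
- by move=> p; rewrite /relative_entropy; case: ifP.
- move=> y p [_ [[psp tp] _]] clp.
  have tr1 (A : 'M[R[i]]_(n1 * n2)) : \tr A = 1 -> complex.Re (\tr A) <= 1 by move=> ->.
  apply/relative_entropy_le => //; first exact: tr1.
  (* The sublevel set is cut out by one continuous inequality for each [k], and each of them passes
     to the closure. *)
  move=> k k0.
  have cF : {for p, continuous (fun x => neg_entropy rho - tr_ln_riemann rho k 0 (X x))}.
    by apply: subl_continuous_at; apply: tr_ln_riemann_continuous => // j; exact: ln_denom_mx0_unit.
  apply: (closure_sublevel (K := K) cF); apply: closure_subset clp => x [Kx /= fx]; split => //=.
  have [_ [[psx tx] _]] := Kx.
  by move/relative_entropy_le: fx; apply => //; exact: tr1.
have pptX : is_ppt_state (X p) := pK.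
apply: (ex_intro2 _ _ (X p) pptX) => sigma ppt.
by have := pmin _ (Kenc _ ppt); rewrite Xenc.
Qed.

End Minimum.

(** * The optimality condition *)

Section FirstOrder.
Variables (R : realType) (n : nat).
Implicit Types (A B D rho tau U : 'M[R[i]]_n) (d : 'I_n -> R) (a : R).

Lemma pd_of_psdB A a : 0 < a -> psd (A - (real_complex R a)%:M) -> pd A.
Proof.
move=> a0 h; have pA : A = A - (real_complex R a)%:M + (real_complex R a)%:M by rewrite subrK.
have /psdE[hB qB] := h.
rewrite pA; split; first by rewrite adjmxD hB adjmx_real.
move=> v v0; rewrite qfD qf_scalar ltr_wpDl // mulr_gt0 //; exact: sqnorm_gt0.
Qed.

Lemma psdB_udiag U d a : U \is unitarymx ->
  psd (udiag U d - (real_complex R a)%:M) <-> forall i, a <= d i.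
Proof.
move=> hU; split=> [h i|h].
  by have := weight_ge0 U i h; rewrite -(udiag_const a hU) udiagN udiagD weight_udiag // subr_ge0.
by rewrite -(udiag_const a hU) udiagN udiagD; apply: udiag_psd => i; rewrite subr_ge0.
Qed.

Lemma herm_lower_bound A : A^t* = A ->
  exists2 a, 0 <= a & psd (A + (real_complex R a)%:M).
Proof.
move=> /herm_udiag[U [d [hU ->]]]; exists (\sum_i `|d i|); first exact: sumr_ge0.
rewrite -(udiag_const _ hU) udiagD; apply: udiag_psd => i; rewrite (bigD1 i) //= addrA.
by rewrite addr_ge0 ?sumr_ge0 // -lerBlDl sub0r lerNl lerNnormlW.
Qed.

Lemma mxtrace_sum (I : Type) (r : seq I) (F : I -> 'M[R[i]]_n) :
  \tr (\sum_(k <- r) F k) = \sum_(k <- r) \tr (F k).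
Proof. exact: (big_morph _ (@mxtraceD _ _) (@mxtrace0 _ _)). Qed.

(* k times the gradient of [tr_ln_riemann rho k 1] at tau. *)
Definition dual_mx rho k tau : 'M[R[i]]_n :=
  \sum_(j < k) invmx (ln_denom_mx ((j + 1)%:R / k%:R) tau) *m rho *m
    invmx (ln_denom_mx ((j + 1)%:R / k%:R) tau).

Lemma invmx_ln_denom_mx_herm u tau : tau^t* = tau ->
  (invmx (ln_denom_mx u tau))^t* = invmx (ln_denom_mx u tau).
Proof.
move=> ht; have hM : (ln_denom_mx u tau)^t* = ln_denom_mx u tau.
  by rewrite /ln_denom_mx adjmxD adjmxZ adjmxD adjmxN ht (adjmx_real n 1).
by rewrite trmx_inv map_invmx hM.
Qed.

(** Each summand is a congruence of [rho] by an invertible hermitian resolvent, and [k > 0] provides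
    at least one summand. *)
Lemma dual_mx_pd rho k tau : (0 < k)%N -> pd rho -> pd tau -> pd (dual_mx rho k tau).
Proof.
move=> k0 [hr pr] pt; have ht := pt.1.
have hK (j : 'I_k) : (invmx (ln_denom_mx ((j + 1)%:R / k%:R) tau) *m rho *m
    invmx (ln_denom_mx ((j + 1)%:R / k%:R) tau))^t* =
    invmx (ln_denom_mx ((j + 1)%:R / k%:R) tau) *m rho *m
      invmx (ln_denom_mx ((j + 1)%:R / k%:R) tau).
  by rewrite !adjmxM invmx_ln_denom_mx_herm // hr mulmxA.
split.
  apply/matrixP => a b; rewrite !mxE !summxE rmorph_sum; apply: eq_bigr => j _.
  by rewrite -[in RHS]hK !mxE.
move=> v v0; rewrite qf_sum.
have pos (j : 'I_k) : 0 < qf (invmx (ln_denom_mx ((j + 1)%:R / k%:R) tau) *m rho *m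
    invmx (ln_denom_mx ((j + 1)%:R / k%:R) tau)) v.
  rewrite -{1}(invmx_ln_denom_mx_herm _ ht) qf_congr; apply: pr.
  have uM : invmx (ln_denom_mx ((j + 1)%:R / k%:R) tau) \in unitmx by rewrite unitmx_inv
    ln_denom_mx1_unit.
  by apply: contra v0 => /eqP h; rewrite -(mulKmx uM v) h mulmx0.
case: k k0 pos {hK} => // k _ pos.
rewrite big_ord_recl ltr_pwDl // ?pos // sumr_ge0 // => j _; exact/ltW/pos.
Qed.

(* By [ln_integrand_mx_sub] the difference quotient along D is an exact expression in
   resolvents, continuous at t = 0. *)
Lemma first_order rho k tau D t0 : (0 < k)%N -> 0 < t0 -> pd tau ->
  (forall t, 0 < t -> t <= t0 -> pd (tau + real_complex R t *: D) /\
     tr_ln_riemann rho k 1 (tau + real_complex R t *: D) <= tr_ln_riemann rho k 1 tau) ->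
  complex.Re (\tr (dual_mx rho k tau *m D)) <= 0.
Proof.
move=> k0 t00 ptau hmax.
pose M (j : 'I_k) := ln_denom_mx ((j + 1)%:R / k%:R) tau.
pose Mt (t : R) (j : 'I_k) := ln_denom_mx ((j + 1)%:R / k%:R) (tau + real_complex R t *: D).
(* For admissible [t > 0], [t * G t] is [k] times the increment of the Riemann sum; [G 0] pairs the
   gradient with [D]. *)
pose G (t : R) := complex.Re (\sum_(j < k) \tr (rho *m (invmx (M j) *m D *m invmx (Mt t j)))).
have G0 : G 0 = complex.Re (\tr (dual_mx rho k tau *m D)).
  rewrite /G /dual_mx mulmx_suml mxtrace_sum; congr (complex.Re _); apply: eq_bigr => j _ /=.
  by rewrite /Mt rmorph0 scale0r addr0 -/(M j) mulmxA mxtrace_mulC !mulmxA.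
rewrite -G0.
have contG : {for 0, continuous G}.
  suff : ccont (0 : R) (fun t => \sum_(j < k) \tr (rho *m (invmx (M j) *m D *m invmx (Mt t j)))).
    by case.
  apply: ccont_sum => j; apply: ccont_tr; apply: mcontM; first exact: mcont_cst.
  apply: mcontM; first exact: mcont_cst.
  apply: mcont_inv; first by rewrite /Mt rmorph0 scale0r addr0; exact: ln_denom_mx1_unit.
  apply: mcont_ln_denom_mx; apply: mcontD; first exact: mcont_cst.
  apply: mcontZ; last exact: mcont_cst.
  by split; rewrite /prop_for /continuous_at /=; [exact: cvg_id | exact: cvg_cst].
(* [0] lies in the closure of the interval [0 < t <= t0], on which [G] is nonpositive. *)
apply: (closure_sublevel (K := [set t | 0 < t <= t0]) contG) => B.
move=> /nbhs_ballP[e /= e0 hB].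
pose t := Num.min t0 (e / 2).
have t_gt0 : 0 < t by rewrite lt_min t00 divr_gt0.
have t_le : t <= t0 by rewrite ge_min lexx.
exists t; split; last first.
  apply: hB; rewrite /ball /= sub0r normrN gtr0_norm // gt_min.
  by rewrite ltr_pdivrMr // ltr_pMr ?ltr1n ?orbT.
split; first by rewrite /= t_gt0 t_le.
have [pt hF] := hmax t t_gt0 t_le.
have k0R : 0 < k%:R^-1 :> R by rewrite invr_gt0 ltr0n.
move: hF; rewrite -subr_le0 /tr_ln_riemann -mulrBr pmulr_rle0 // -sumrB => hF.
rewrite /= -(pmulr_rle0 _ t_gt0) /G Rec_sum mulr_sumr; apply: le_trans hF.
rewrite le_eqVlt; apply/orP; left; apply/eqP; apply: eq_bigr => j _.
rewrite -RecB -mxtraceB -mulmxBr ln_integrand_mx_sub ?ln_denom_mx1_unit // -/(M j).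
rewrite [tau + _]addrC addrK -[in RHS]addrC -/(Mt t j) -scalemxAr -scalemxAl -scalemxAr.
by rewrite mxtraceZ RecZ.
Qed.

End FirstOrder.

(** * Vanishing of the negative part at an optimum *)

Section Variational.
Variables (R : realType) (n1 n2 : nat).
Hypothesis qubit : n1 = 2%N \/ n2 = 2%N.
Implicit Types (P N p q phi tau rho : 'M[R[i]]_(n1 * n2)).

Lemma psd_outer n (v : 'cV[R[i]]_n) : psd (v *m v^t*).
Proof.
apply/psdE; split; first by rewrite adjmxM trmxCK.
move=> w; rewrite /qf mulmxA -mulmxA; have -> : v^t* *m w = (w^t* *m v)^t*.
  by rewrite adjmxM trmxCK.
move: (w^t* *m v) => u; rewrite mxE big_ord1 !mxE mulrC mul_conj_sqnormc; exact: sqnormc_ge0.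
Qed.

Lemma tr_mul_outer n (A : 'M[R[i]]_n) (v : 'cV[R[i]]_n) :
  complex.Re (\tr (A *m (v *m v^t*))) = qf A v.
Proof.
by rewrite mulmxA mxtrace_mulC mulmxA /mxtrace big_ord1.
Qed.

(** Competitors with [q = 0] and [p] a normalized rank-one projection give [ptranspose phi <= c];
    the qubit then gives [ptranspose phi + c > 0]. The trace of the latter against [N] is
    nonpositive by the trace constraint, so [Re_tr_pd_le0] applies. *)
Lemma dual_optimal_neg_part phi P N : pd phi -> psd P -> psd N ->
  complex.Re (\tr P) + complex.Re (\tr N) <= 1 -> psd (ptranspose (P - N)) ->
  (forall p q, psd p -> psd q -> complex.Re (\tr p) + complex.Re (\tr q) <= 1 ->
     complex.Re (\tr (phi *m ptranspose (p - q))) <=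
     complex.Re (\tr (phi *m ptranspose (P - N)))) -> N = 0.
Proof.
move=> pphi pP pN trPN ptau opt; set c := complex.Re _ in opt.
have c0 : 0 <= c by exact: (Re_tr_psd_ge0 (pd_psd pphi) ptau).
have le_c w : qf (ptranspose phi) w <= qf (real_complex R c)%:M w.
  have [->|w0] := eqVneq w 0; first by rewrite /qf !mulmx0 !mxE.
  have s0 := sqnorm_gt0 w0; set s := \sum_i _ in s0.
  pose p := real_complex R s^-1 *: (w *m w^t*).
  have pp : psd p by apply: psdZ; [rewrite invr_ge0 ltW | exact: psd_outer].
  have trp : complex.Re (\tr p) = 1.
    rewrite mxtraceZ RecZ -[w *m _]mul1mx tr_mul_outer.
    have -> : (1%:M : 'M[R[i]]_(n1 * n2)) = (real_complex R 1)%:M by rewrite rmorph1.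
    by rewrite qf_scalar mul1r -/s mulVf // gt_eqF.
  have := opt p 0 pp (psd0 _ _); rewrite mxtrace0 addr0 trp lexx => /(_ isT).
  rewrite subr0 -tr_mul_ptranspose -scalemxAr mxtraceZ RecZ tr_mul_outer qf_scalar -/s.
  by rewrite mulrC ler_pdivrMr.
have hphi : (ptranspose phi)^t* = ptranspose phi by rewrite ptranspose_adj pphi.1.
have hc := adjmx_real (n1 * n2)%N c.
have pdB : pd (ptranspose phi + (real_complex R c)%:M).
  split; first by rewrite adjmxD hphi hc.
  by move=> v v0; rewrite qfD; exact: ptranspose_pd_bound.
have psdB : psd ((real_complex R c)%:M - ptranspose phi).
  apply/psdE; split; first by rewrite adjmxD adjmxN hphi hc.
  by move=> v; rewrite qfD qfN subr_ge0.
have trc (A : 'M[R[i]]_(n1 * n2)) : complex.Re (\tr ((real_complex R c)%:M *m A)) =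
    c * complex.Re (\tr A) by rewrite mul_scalar_mx mxtraceZ RecZ.
have := Re_tr_psd_ge0 psdB pP; rewrite mulmxBl mxtraceB RecB trc => leP.
apply: (Re_tr_pd_le0 pdB pN); rewrite mulmxDl mxtraceD RecD trc.
have : c = complex.Re (\tr (ptranspose phi *m P)) - complex.Re (\tr (ptranspose phi *m N)).
  by rewrite -RecB -mxtraceB -mulmxBr tr_mul_ptranspose.
have : c * complex.Re (\tr P) + c * complex.Re (\tr N) <= c.
  by rewrite -mulrDr ler_piMr.
lra.
Qed.

Lemma ptranspose_psd_herm P N : psd P -> psd N ->
  (ptranspose (P - N))^t* = ptranspose (P - N).
Proof.
by move=> /psdE[hP _] /psdE[hN _]; rewrite ptranspose_adj adjmxD adjmxN hP hN.
Qed.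

(** Competitors must stay above [dl], whereas the maximizer is above [dl + dl]: the constraint is
    inactive, and short steps towards an arbitrary pair [p], [q] remain admissible. [first_order]
    then supplies the optimality required by [dual_optimal_neg_part]. *)
Lemma tr_ln_riemann_maximizer_neg_part rho k (dl : R) P N : (0 < k)%N -> 0 < dl -> pd rho ->
  psd P -> psd N -> complex.Re (\tr P) + complex.Re (\tr N) <= 1 ->
  psd (ptranspose (P - N) - (real_complex R (dl + dl))%:M) ->
  (forall p q, psd p -> psd q -> complex.Re (\tr p) + complex.Re (\tr q) <= 1 ->
     psd (ptranspose (p - q) - (real_complex R dl)%:M) ->
     tr_ln_riemann rho k 1 (ptranspose (p - q)) <= tr_ln_riemann rho k 1 (ptranspose (P - N))) ->
       N = 0.
Proof.
move=> k0 dl0 prho pP pN trPN tau_ge opt; set tau := ptranspose (P - N).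
have dl2 : 0 < dl + dl by rewrite addr_gt0.
have ptau : pd tau by exact: pd_of_psdB tau_ge.
have pphi := dual_mx_pd k0 prho ptau.
apply: (dual_optimal_neg_part pphi pP pN trPN (pd_psd ptau)) => p q pp pq trpq.
set Z := ptranspose (p - q).
rewrite -subr_le0 -RecB -mxtraceB -mulmxBr.
have [B B0 hB] := herm_lower_bound (ptranspose_psd_herm pp pq).
(* Since [tau >= 2 dl] and [Z >= - B], the point at parameter [t] is at least
   [2 dl - t * (B + 2 dl)], hence at least [dl] for [t <= t0]. *)
pose t0 := dl / (B + (dl + dl)).
have den0 : 0 < B + (dl + dl) by rewrite ltr_wpDl.
have t00 : 0 < t0 by rewrite divr_gt0.
apply: (first_order k0 t00 ptau) => t t_gt0 t_le.
have tden : t * (B + (dl + dl)) <= dl by rewrite -ler_pdivlMr.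
have t1 : t <= 1 by nra.
have t'0 : 0 <= 1 - t by rewrite subr_ge0.
pose rc := real_complex R.
pose Pt := rc (1 - t) *: P + rc t *: p; pose Nt := rc (1 - t) *: N + rc t *: q.
have EtauZ : tau + rc t *: (Z - tau) = ptranspose (Pt - Nt).
  have -> : Pt - Nt = rc (1 - t) *: (P - N) + rc t *: (p - q).
    by rewrite /Pt /Nt !scalerBr opprD addrACA.
  rewrite ptransposeD !ptransposeZ -/tau -/Z /rc rmorphB rmorph1 scalerBl scale1r scalerBr.
  by rewrite [X in tau + X]addrC addrA.
have psdt : psd (tau + rc t *: (Z - tau) - (rc dl)%:M).
  have -> : tau + rc t *: (Z - tau) - (rc dl)%:M =
      rc (1 - t) *: (tau - (rc (dl + dl))%:M) + rc t *: (Z + (rc B)%:M) +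
      (rc (dl - t * (B + (dl + dl))))%:M.
    rewrite /rc; apply/matrixP => i j; rewrite !mxE.
    move: (tau i j) (Z i j) => x y.
    rewrite !(rmorphB, rmorphD, rmorphM, rmorph1) /=.
    by case: (i == j); rewrite ?mulr1n ?mulr0n; ring.
  apply: psdD; last by apply: psd_real; rewrite subr_ge0.
  exact: (psdD (psdZ t'0 tau_ge) (psdZ (ltW t_gt0) hB)).
split; first exact: pd_of_psdB psdt.
rewrite EtauZ in psdt *.
apply: (opt _ _ (psdD (psdZ t'0 pP) (psdZ (ltW t_gt0) pp))
  (psdD (psdZ t'0 pN) (psdZ (ltW t_gt0) pq)) _ psdt).
rewrite !mxtraceD !mxtraceZ !RecD !RecZ addrACA -!mulrDr.
nra.
Qed.

End Variational.

(** * Existence of a maximizer away from the singular matrices *)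

Section Maximizer.
Variable R : realType.

Lemma add_continuous_at (T : topologicalType) (p : T) (f g : T -> R) :
  {for p, continuous f} -> {for p, continuous g} -> {for p, continuous (fun x => f x + g x)}.
Proof. by move=> cf cg; exact: cvgD. Qed.

Lemma psdB_le n (A : 'M[R[i]]_n) (a b : R) : b <= a ->
  psd (A - (real_complex R a)%:M) -> psd (A - (real_complex R b)%:M).
Proof.
move=> ba hA; have ba0 : 0 <= a - b by rewrite subr_ge0.
have -> : A - (real_complex R b)%:M =
    A - (real_complex R a)%:M + (real_complex R (a - b))%:M.
  by rewrite rmorphB raddfB addrA subrK.
exact: (psdD hA (psd_real n ba0)).
Qed.

Lemma weight_ge n (rho U : 'M[R[i]]_n) (r : R) i : U \is unitarymx ->
  psd (rho - (real_complex R r)%:M) -> r <= weight U rho i.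
Proof.
move=> hU h; have := weight_ge0 U i h.
have -> : - (real_complex R r)%:M = (real_complex R (- r))%:M :> 'M_n.
  by rewrite rmorphN raddfN.
by rewrite weightD weight_const // subr_ge0.
Qed.

(* All terms of Tr rho ln tau are nonpositive, so each of them is at least f0. *)
Lemma tr_ln_riemann_barrier n (rho tau : 'M[R[i]]_n) k (r f0 : R) : (0 < k)%N -> 0 < r ->
  psd (rho - (real_complex R r)%:M) -> pd tau -> complex.Re (\tr tau) <= 1 ->
  f0 <= tr_ln_riemann rho k 1 tau -> psd (tau - (real_complex R (expR (f0 / r)))%:M).
Proof.
move=> k0 r0 hrho /pd_udiag[U [d [hU tE d0]]]; rewrite {}tE => tr1.
have d1 i : d i <= 1 by apply: (eigen_le1 i hU _ tr1) => j; exact: ltW.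
rewrite (tr_ln_riemann1_udiag rho k0 hU d0) => hf0; apply/(psdB_udiag d _ hU) => i.
have w_ge j : r <= weight U rho j by exact: weight_ge.
have w0 j : 0 <= weight U rho j by apply: le_trans (w_ge j); exact: ltW.
have ln0 j : ln (d j) <= 0 by rewrite ln_le0.
rewrite -(lnK (d0 i : d i \is Num.pos)) ler_expR ler_pdivrMr // mulrC.
apply: (le_trans hf0); apply: (@le_trans _ _ (\sum_j weight U rho j * ln (d j))).
  by apply: ler_sum => j _; rewrite ler_wpM2l // ln_riemann1_le_ln.
rewrite (bigD1 i) //= -[leRHS]addr0 lerD //; last first.
  by rewrite sumr_le0 // => j _; rewrite mulr_ge0_le0.
by rewrite ler_wnM2r.
Qed.

Variables (n1 n2 : nat).
Hypothesis qubit : n1 = 2%N \/ n2 = 2%N.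
Implicit Types (P N rho tau : 'M[R[i]]_(n1 * n2)).

(* Writing tau as the partial transpose of P - N turns the bound on the trace norm of the
   partial transpose of tau into the linear constraint Tr P + Tr N <= 1. *)
Lemma ppt_improvement rho k (r a : R) P0 N0 : (0 < k)%N -> 0 < r ->
  psd (rho - (real_complex R r)%:M) -> psd P0 -> psd N0 ->
  complex.Re (\tr P0) + complex.Re (\tr N0) <= 1 -> 0 < a ->
  psd (ptranspose (P0 - N0) - (real_complex R a)%:M) ->
  exists tau, [/\ pd tau, psd (ptranspose tau), complex.Re (\tr tau) <= 1 &
    tr_ln_riemann rho k 1 (ptranspose (P0 - N0)) <= tr_ln_riemann rho k 1 tau].
Proof.
move=> k0 r0 hrho pP0 pN0 tr0 a0 ge0; set tau0 := ptranspose _ in ge0 *.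
(* [dl <= a] makes the starting pair admissible, and [dl + dl] is at most the barrier for values no
   less than that of [tau0], so the maximizer is strictly inside the constraint. *)
pose m := Num.min a (expR (tr_ln_riemann rho k 1 tau0 / r)); pose dl := m / 2.
have m0 : 0 < m by rewrite lt_min a0 expR_gt0.
have dl0 : 0 < dl by rewrite divr_gt0.
have dlm : dl + dl = m by rewrite /dl; field.
have dla : dl <= a.
  by apply: (@le_trans _ _ m); rewrite ?ge_min ?lexx // -dlm lerDl ltW.
have [XP [XN [cP cN encP encN]]] : exists XP XN : coords R (n1 * n2)%N -> 'M[R[i]]_(n1 * n2),
    [/\ forall x, mcont x XP, forall x, mcont x XN,
        forall P N, XP (coords_of_mx P N) = P & forall P N, XN (coords_of_mx P N) = N].
  exists (mx_of_coords true), (mx_of_coords false).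
  split; [exact: mcont_mx_of_coords | exact: mcont_mx_of_coords | |] => P N.
    exact: (coords_of_mxK true).
  exact: (coords_of_mxK false).
have ctr (X : coords R (n1 * n2)%N -> 'M[R[i]]_(n1 * n2)) x : mcont x X ->
    {for x, continuous (fun y => complex.Re (\tr (X y)))}.
  by move=> cX; case: (ccont_tr cX).
pose XT x := ptranspose (XP x - XN x).
have cT x : mcont x XT.
  by move=> i j; under eq_fun do rewrite mxE; apply: mcontD; [exact: cP | apply: mcontN; exact: cN].
pose C := [set x | psd (XP x)] `&` [set x | psd (XN x)] `&`
  [set x | complex.Re (\tr (XP x)) + complex.Re (\tr (XN x)) <= 1] `&`
  [set x | psd (XT x - (real_complex R dl)%:M)].
have clC : closed C.
  apply: closedI; last first.
    by apply: closed_psd => x; apply: mcontD; [exact: cT | exact: mcont_cst].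
  apply: closedI; first exact: (closedI (closed_psd cP) (closed_psd cN)).
  apply: closed_le_cst => x.
  exact: (add_continuous_at (ctr _ _ (cP x)) (ctr _ _ (cN x))).
pose K := @unit_box R (n1 * n2)%N `&` C.
have cK : compact K by exact: (compact_closedI (@unit_box_compact _ _) clC).
have Kenc P N : psd P -> psd N -> complex.Re (\tr P) + complex.Re (\tr N) <= 1 ->
    psd (ptranspose (P - N) - (real_complex R dl)%:M) -> K (coords_of_mx P N).
  move=> pP pN tr1 h.
  have trP0 := psd_tr_ge0 pP; have trN0 := psd_tr_ge0 pN.
  have trP1 : complex.Re (\tr P) <= 1 by lra.
  have trN1 : complex.Re (\tr N) <= 1 by lra.
  split; first exact: (unit_box_coords_of_mx pP trP1 pN trN1).
  split; last by move=> /=; rewrite /XT encP encN; exact: h.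
  split; last by move=> /=; rewrite encP encN; exact: tr1.
  by split; move=> /=; [rewrite encP; exact: pP | rewrite encN; exact: pN].
have pdT x : K x -> pd (XT x) by move=> [_ [_ h]]; exact: pd_of_psdB h.
have cF x : K x -> {for x, continuous (fun x => tr_ln_riemann rho k 1 (XT x))}.
  by move=> Kx; exact: (@tr_ln_riemann_continuous R _ _ x XT rho k 1 (cT x) (fun j =>
    ln_denom_mx1_unit j (pdT x Kx))).
have K0 : K !=set0 by exists (coords_of_mx P0 N0);
  exact: (Kenc P0 N0 pP0 pN0 tr0 (psdB_le dla ge0)).
have [x Kx xmax] := continuous_attains_max cK K0 cF.
have max P N : psd P -> psd N -> complex.Re (\tr P) + complex.Re (\tr N) <= 1 ->
    psd (ptranspose (P - N) - (real_complex R dl)%:M) ->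
    tr_ln_riemann rho k 1 (ptranspose (P - N)) <= tr_ln_riemann rho k 1 (XT x).
  move=> pP pN tr1 h; have := xmax _ (Kenc P N pP pN tr1 h).
  by rewrite {1}/XT encP encN.
have pT := pdT x Kx; have [_ [[[pP pN] trx] hx]] := Kx.
have le0 : tr_ln_riemann rho k 1 tau0 <= tr_ln_riemann rho k 1 (XT x) by exact:
  (max _ _ pP0 pN0 tr0 (psdB_le dla ge0)).
have trT : complex.Re (\tr (XT x)) <= 1.
  have trN0 := psd_tr_ge0 pN.
  have trx' : complex.Re (\tr (XP x)) + complex.Re (\tr (XN x)) <= 1 := trx.
  rewrite /XT tr_ptranspose mxtraceB RecB; apply: le_trans trx'.
  by rewrite lerD2l (@le_trans _ _ 0) // oppr_le0.
have bar := tr_ln_riemann_barrier k0 r0 hrho pT trT le0.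
have N0' : XN x = 0.
  apply: (tr_ln_riemann_maximizer_neg_part qubit k0 dl0 (pd_of_psdB r0 hrho) pP pN trx _ max).
  by apply: psdB_le bar; rewrite dlm ge_min lexx orbT.
exists (XT x); split; [exact: pT | | exact: trT | exact: le0].
rewrite /XT ptransposeK N0' subr0; exact: pP.
Qed.

End Maximizer.

(** * The Rains bound *)

Section TraceNorm.
Variables (R : realType) (n : nat).
Implicit Types (A U : 'M[R[i]]_n) (d : 'I_n -> R).

Lemma tr_udiag U d : U \is unitarymx -> \tr (udiag U d) = real_complex R (\sum_i d i).
Proof.
move=> hU; rewrite /udiag mxtrace_mulC mulmxA (unitarymxP hU) mul1mx rmorph_sum.
by apply: eq_bigr => i _; rewrite !mxE eqxx mulr1n.
Qed.

Lemma trnorm_udiag U d : U \is unitarymx -> trnorm (udiag U d) = \sum_i `|d i|.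
Proof.
move=> hU; rewrite /trnorm /absmx udiag_herm udiagM // mxfun_udiag // tr_udiag //=.
by apply: eq_bigr => i _; rewrite -sqrtr_sqr expr2.
Qed.

Lemma trnorm_psd A : psd A -> trnorm A = complex.Re (\tr A).
Proof.
move=> /psd_udiag[U [d [hU -> d0]]]; rewrite trnorm_udiag // tr_udiag //=.
by apply: eq_bigr => i _; rewrite ger0_norm.
Qed.

Lemma jordan_decomposition A : A^t* = A -> exists P N,
  [/\ psd P, psd N, A = P - N & complex.Re (\tr P) + complex.Re (\tr N) = trnorm A].
Proof.
move=> /herm_udiag[U [d [hU ->]]].
exists (udiag U (fun i => Num.max (d i) 0)), (udiag U (fun i => Num.max (- d i) 0)).
have m0 (x : R) : 0 <= Num.max x 0 by rewrite le_max lexx orbT.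
split; [exact: udiag_psd | exact: udiag_psd | |].
  rewrite udiagN udiagD; apply: eq_udiag => i; rewrite /Num.max.
  by case: ifP; case: ifP; lra.
rewrite (tr_udiag _ hU) (tr_udiag _ hU).
rewrite (trnorm_udiag _ hU) /=.
rewrite -big_split /=.
apply: eq_bigr => i _.
have [di|di] := leP 0 (d i).
  by rewrite ger0_norm // max_r ?addr0 // oppr_le0.
by rewrite ltr0_norm // max_l ?add0r // oppr_ge0 ltW.
Qed.

End TraceNorm.

(** The left side is [ln (1 + e / (1 - e))], at most [e / (1 - e)], and [1 - e] is at least one
    half. *)
Lemma neg_ln_onem_le (R : realType) (e : R) : 0 <= e -> e <= 2^-1 -> - ln (1 - e) <= 2 * e.
Proof.
move=> e0 e12; have e1 : 0 < 1 - e by lra.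
rewrite -lnV ?posrE //.
have -> : (1 - e)^-1 = 1 + e / (1 - e) by field; rewrite gt_eqF.
have x0 : 0 <= e / (1 - e) by rewrite divr_ge0 // ltW.
apply: (le_trans (le_ln1Dx _)); first by lra.
rewrite ler_pdivrMr //; have : 0 <= e * (2^-1 - e) by rewrite mulr_ge0 // subr_ge0.
lra.
Qed.

(** Controls the error term of [ppt_approximation], with [m] the dimension: the mixing weight [e] is
    fixed first, and then the number [k] of nodes. *)
Lemma smoothing_error_small (R : realType) (m eta : R) : 1 <= m -> 0 < eta ->
  exists (e : R) (k : nat), [/\ 0 < e, e <= 2^-1, (0 < k)%N &
    - ln (1 - e) + ((k%:R * (e / m))^-1 + e * - ln (e / m)) / (1 - e) <= eta].
Proof.
move=> m1 eta0; have m0 : 0 < m by lra.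
(* With e = a^2 / m one has e * ln (m / e) = 2 * e * ln (m / a) <= 2 * a. *)
pose a := Num.min (2^-1 : R) (eta / 8).
have a0 : 0 < a by rewrite lt_min invr_gt0 ltr0n divr_gt0.
have a12 : a <= 2^-1 by rewrite ge_min lexx.
have a8 : 8 * a <= eta.
  by rewrite mulrC -ler_pdivlMr // ge_min lexx orbT.
pose e := a ^+ 2 / m; pose q := e / m.
have e0 : 0 < e by rewrite divr_gt0 // exprn_gt0.
have q0 : 0 < q by rewrite divr_gt0.
have ea : e <= a / 2.
  apply: (@le_trans _ _ (a ^+ 2)); last by rewrite expr2 ler_wpM2l // ltW.
  by rewrite ler_pdivrMr // ler_peMr // ltW // exprn_gt0.
pose k := (Num.truncn (a * q)^-1).+1.
have k0 : (0 < k)%N by [].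
have kR : (a * q)^-1 <= k%:R by rewrite ltW // truncnS_gt.
have kR0 : 0 < k%:R :> R by rewrite ltr0n.
exists e, k; split => //; first by lra.
have kq : (k%:R * q)^-1 <= a.
  have kq0 : 0 < k%:R * q by rewrite mulr_gt0.
  rewrite invf_ple ?posrE // -ler_pdivrMr // -invfM; exact: kR.
have e1 : 0 < 1 - e by lra.
have h1 : - ln (1 - e) <= 2 * e by apply: neg_ln_onem_le; lra.
have h2 : e * - ln q <= 2 * a.
  have -> : - ln q = 2 * ln (m / a).
    rewrite -lnV ?posrE // /q /e mulr_natl -lnXn ?divr_gt0 //; congr ln.
    by field; rewrite !gt_eqF.
  have ln1 : ln (m / a) <= m / a.
    by apply/ltW/ln_sublinear; rewrite divr_gt0.
  have -> : 2 * a = e * (2 * (m / a)) by rewrite /e; field; rewrite !gt_eqF.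
  by rewrite ler_wpM2l ?ler_pM2l // ltW.
have h3 : ((k%:R * q)^-1 + e * - ln q) / (1 - e) <= 6 * a.
  rewrite ler_pdivrMr // (le_trans (lerD kq h2)) // mulrBr.
  have : 6 * a * e <= 3 * a; last by lra.
  by rewrite mulrAC ler_wpM2r ?ltW //; lra.
(* The two terms are at most [2 * e <= a] and [6 * a], within [8 * a <= eta]. *)
rewrite -/q; lra.
Qed.

(** * Comparison of the Rains bound with PPT states *)

Section RainsBound.
Variables (R : realType) (n1 n2 : nat).
Hypothesis qubit : n1 = 2%N \/ n2 = 2%N.
Implicit Types (rho sigma tau : 'M[R[i]]_(n1 * n2)).

Lemma state_psd n (A : 'M[R[i]]_n) : is_state A -> psd A.
Proof. by case. Qed.

Lemma state_Re_tr n (A : 'M[R[i]]_n) : is_state A -> complex.Re (\tr A) = 1.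
Proof. by case=> _ ->. Qed.

Lemma state_dim_gt0 n (A : 'M[R[i]]_n) : is_state A -> (0 < n)%N.
Proof.
case: n A => // A /state_Re_tr; rewrite /mxtrace big_ord0 => /eqP.
by rewrite eq_sym oner_eq0.
Qed.

Lemma Re_tr_scalar n (a : R) : complex.Re (\tr ((real_complex R a)%:M : 'M_n)) = a * n%:R.
Proof. by rewrite mxtrace_scalar raddfMn /= mulr_natr. Qed.

Lemma normalize_ppt tau : pd tau -> psd (ptranspose tau) -> 0 < complex.Re (\tr tau) ->
  is_ppt_state (real_complex R (complex.Re (\tr tau))^-1 *: tau).
Proof.
move=> pt pGt T0; set T := complex.Re _ in T0 *.
have Ti0 : 0 <= T^-1 by rewrite invr_ge0 ltW.
split; last by rewrite ptransposeZ; exact: psdZ.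
split; first exact: (psdZ Ti0 (pd_psd pt)).
have [U [d [hU tE _]]] := pd_udiag pt.
rewrite mxtraceZ {1}tE tr_udiag // -rmorphM (udiag_sum _ hU) -tE -/T mulVf ?rmorph1 //.
by rewrite gt_eqF.
Qed.

(** Dividing [tau] by its trace, which is at most one, lowers no eigenvalue, so the entropy term can
    only decrease. *)
Lemma normalized_entropy_le rho tau : is_state rho -> pd tau ->
  complex.Re (\tr tau) <= 1 -> 0 < complex.Re (\tr tau) ->
  (relative_entropy rho (real_complex R (complex.Re (\tr tau))^-1 *: tau) <=
   (neg_entropy rho - complex.Re (\tr (rho *m logmx tau)))%:E)%E.
Proof.
move=> srho pt; set T := complex.Re _ => T1 T0.
have [U [d [hU -> d0]]] := pd_udiag pt.
have Ti0 : 0 < T^-1 by rewrite invr_gt0.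
have dT i : 0 < T^-1 * d i by rewrite mulr_gt0.
rewrite udiagZ (relative_entropy_udiag _ (state_psd srho) hU) asboolT; last first.
  by move=> i /eqP; rewrite gt_eqF.
rewrite lee_fin lerD2l lerN2 /logmx (mxfun_udiag _ _ hU) Re_tr_udiag; apply: ler_sum => i _.
rewrite ler_wpM2l ?(weight_ge0 _ _ (state_psd srho)) // /ln_supp /= dT d0.
rewrite lnM ?posrE // lerDr ln_ge0 // invf_ge1 //.
Qed.

(** Partial transposition keeps the trace, so the Jordan parts satisfy [Tr P - Tr N = 1]. *)
Lemma ptranspose_trnorm_ge1 sigma : is_state sigma -> 1 <= trnorm (ptranspose sigma).
Proof.
move=> ss; have /psdE[hs _] := state_psd ss.
have [P [N [pP pN E <-]]] : exists P N, [/\ psd P, psd N, ptranspose sigma = P - N &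
    complex.Re (\tr P) + complex.Re (\tr N) = trnorm (ptranspose sigma)].
  by apply: jordan_decomposition; rewrite ptranspose_adj hs.
rewrite -(state_Re_tr ss) -tr_ptranspose E mxtraceB RecB lerD2l.
by rewrite (@le_trans _ _ 0) ?oppr_le0 ?psd_tr_ge0.
Qed.

(** Both [rho] and the rescaled [udiag U d] are made positive definite by adding [q] times the
    identity. [ppt_improvement] then provides a PPT competitor for the smoothed problem; the last
    summand collects the costs of smoothing and of the Riemann sum. *)
Lemma ppt_approximation rho U d (e : R) k : is_state rho -> U \is unitarymx ->
  (forall i, 0 <= d i) -> is_state (udiag U d : 'M[R[i]]_(n1 * n2)) ->
  (forall i, d i = 0 -> weight U rho i = 0) -> 0 < e -> e <= 2^-1 -> (0 < k)%N ->
  let q := e / (n1 * n2)%:R in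
  exists2 sigma, is_ppt_state sigma &
  (relative_entropy rho sigma <=
    (neg_entropy rho - \sum_i weight U rho i * ln_supp (d i)
     + ln (trnorm (ptranspose (udiag U d))) +
     (- ln (1 - e) + ((k%:R * q)^-1 + e * - ln q) / (1 - e)))%:E)%E.
Proof.
move=> srho hU d0 ss hker e0 e12 k0 q.
set c := trnorm _.
have c1 : 1 <= c by exact: ptranspose_trnorm_ge1.
have c0 : 0 < c by lra.
have prho := state_psd srho.
have n0 : (0 < n1 * n2)%N := state_dim_gt0 srho.
have nR : 0 < (n1 * n2)%:R :> R by rewrite ltr0n.
have q0 : 0 < q by rewrite divr_gt0.
have qn : q * (n1 * n2)%:R = e by rewrite /q mulfVK // gt_eqF.
have qe : q <= e by rewrite /q ler_pdivrMr // ler_peMr ?(ltW e0) // ler1n.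
have e1 : 0 < 1 - e by lra.
clearbody q.
have hherm : (ptranspose (udiag U d))^t* = ptranspose (udiag U d).
  by rewrite ptranspose_adj udiag_herm.
have [P [N [pP pN EPN trPN]]] := jordan_decomposition hherm.
rewrite -/c in trPN.
pose rc := real_complex R.
(* The added multiple of the identity has trace [e], so this factor makes the traces of [P0] and
   [N0] add up to [1]. *)
pose b := (1 - e) / c.
have b0 : 0 < b by rewrite divr_gt0.
pose rhoe : 'M[R[i]]_(n1 * n2) := rc (1 - e) *: rho + (rc q)%:M.
pose P0 := rc b *: P + (rc q)%:M; pose N0 := rc b *: N.
pose s i := b * d i + q.
have Etau : ptranspose (P0 - N0) = udiag U s.
  rewrite /P0 /N0 addrAC -scalerBr -EPN ptransposeD ptransposeZ ptransposeK ptranspose_scalar.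
  by rewrite /rc udiagZ -(udiag_const q hU) udiagD.
have prhoe : psd (rhoe - (rc q)%:M).
  by rewrite /rhoe addrK; exact: (psdZ (ltW e1) prho).
have pP0 : psd P0 by exact: (psdD (psdZ (ltW b0) pP) (psd_real _ (ltW q0))).
have pN0 : psd N0 by exact: (psdZ (ltW b0) pN).
have tr0 : complex.Re (\tr P0) + complex.Re (\tr N0) <= 1.
  rewrite /P0 /N0 mxtraceD !mxtraceZ RecD !RecZ Re_tr_scalar qn addrAC -mulrDr trPN.
  by rewrite /b mulfVK ?gt_eqF // subrK.
have ge0 : psd (ptranspose (P0 - N0) - (rc q)%:M).
  rewrite Etau; apply/(psdB_udiag _ _ hU) => i.
  by rewrite /s lerDr mulr_ge0 // ltW.
have [tau [pt pGt trt Fle]] := ppt_improvement qubit k0 q0 prhoe pP0 pN0 tr0 q0 ge0.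
have trt0 : 0 < complex.Re (\tr tau).
  have [V [t [hV -> t0]]] := pd_udiag pt; rewrite -udiag_sum //.
  rewrite (bigD1 (Ordinal n0)) //= ltr_pwDl // sumr_ge0 // => i _; exact: ltW.
exists (real_complex R (complex.Re (\tr tau))^-1 *: tau); first exact: normalize_ppt.
apply: (le_trans (normalized_entropy_le srho pt trt trt0)).
rewrite lee_fin -!addrA lerD2l.
have we_ge V i : V \is unitarymx -> weight V rhoe i = (1 - e) * weight V rho i + q.
  by move=> hV; rewrite /rhoe weightD weightZ weight_const.
have d1 i : d i <= 1 by apply: (eigen_le1 i hU d0); rewrite (state_Re_tr ss).
(* The eigenvalues of [tau] are at most [1], so the logarithms are nonpositive: the extra weight [q]
   and the passage to right sums both lower the sum. *)
have lower : (1 - e) * - complex.Re (\tr (rho *m logmx tau)) <= - tr_ln_riemann rhoe k 1 tau.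
  have [V [t [hV tauE t0]]] := pd_udiag pt.
  rewrite tauE (tr_ln_riemann1_udiag _ k0 hV t0) /logmx (mxfun_udiag _ _ hV) Re_tr_udiag mulrN
    lerN2 mulr_sumr.
  have t1 i : t i <= 1.
    by apply: (eigen_le1 i hV) => [j|]; [exact: ltW | rewrite -tauE].
  apply: ler_sum => i _; rewrite /= t0 (we_ge V i hV) [leRHS]mulrA.
  have w0 := weight_ge0 V i prho.
  apply: (@le_trans _ _ (((1 - e) * weight V rho i + q) * ln (t i))).
    by rewrite ler_wpM2l ?ln_riemann1_le_ln // addr_ge0 ?mulr_ge0 // ltW.
  rewrite mulrDl gerDl mulr_ge0_le0 ?(ltW q0) // ln_le0 //.
have upper : - tr_ln_riemann rhoe k 1 (udiag U s) <=
    (k%:R * q)^-1 + (1 - e) * (- \sum_i weight U rho i * ln_supp (d i) + ln c - ln (1 - e))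
    + e * - ln q.
  have sq i : q <= s i by rewrite /s lerDr mulr_ge0 // ltW.
  have s0 i : 0 < s i by exact: lt_le_trans q0 (sq i).
  have s1 i : s i <= 1.
    have bd : b * d i <= 1 - e.
      rewrite /b mulrAC ler_pdivrMr // ler_wpM2l ?(ltW e1) //.
      exact: le_trans (d1 i) c1.
    by rewrite /s (le_trans (lerD bd qe)) // subrK.
  rewrite (tr_ln_riemann1_udiag _ k0 hU s0).
  have w0 i : 0 <= weight U rho i by exact: weight_ge0.
  have wsum : \sum_i weight U rho i = 1 by rewrite weight_sum // (state_Re_tr srho).
  (* Three estimates per eigenvalue: [g1] compares the right sum with [ln], [g2] handles the added
     weight [q], and [g3] uses [s i >= b * d i] with [ln b = ln (1 - e) - ln c]. *)
  have step i : - (weight U rhoe i * ln_riemann k 1 (s i)) <=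
      weight U rhoe i * (k%:R * q)^-1 +
      ((1 - e) * (- (weight U rho i * ln_supp (d i)) + weight U rho i * (ln c - ln (1 - e)))
       + q * - ln q).
    have wE := we_ge U i hU.
    have we0 : 0 <= weight U rhoe i by rewrite wE addr_ge0 ?mulr_ge0 // ltW.
    have g1 : - ln_riemann k 1 (s i) <= - ln (s i) + (k%:R * q)^-1.
      rewrite lerNl opprD opprK lerBlDr (le_trans (ln_le_ln_riemann1 k0 (s0 i) (s1 i))) // lerD2l.
      have kR : 0 < k%:R :> R by rewrite ltr0n.
      have h1 : 0 < k%:R * s i := mulr_gt0 kR (s0 i).
      have h2 : 0 < k%:R * q := mulr_gt0 kR q0.
      by rewrite lef_pV2 ?posrE // ler_wpM2l // ltW.
    have g2 : q * - ln (s i) <= q * - ln q by rewrite ler_pM2l // lerN2 ler_ln ?posrE.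
    have g3 : - (weight U rho i * ln (s i)) <=
        - (weight U rho i * ln_supp (d i)) + weight U rho i * (ln c - ln (1 - e)).
      have [di|di] := eqVneq (d i) 0; first by rewrite hker // !mul0r oppr0 addr0.
      have {}di : 0 < d i by rewrite lt_neqAle eq_sym di d0.
      rewrite -mulrN -[X in _ <= X + _]mulrN -mulrDr ler_wpM2l // /ln_supp di.
      have : ln (b * d i) <= ln (s i).
        have bd0 : 0 < b * d i := mulr_gt0 b0 di.
        by rewrite ler_ln ?posrE // /s lerDl ltW.
      rewrite lnM ?posrE // /b ln_div ?posrE //.
      move: (ln (s i)) (ln (d i)) (ln c) (ln (1 - e)).
      by clear => x y z w; lra.
    rewrite -mulrN; apply: (le_trans (ler_wpM2l we0 g1)).
    rewrite mulrDr addrC lerD2l wE mulrDl lerD // -mulrA ler_wpM2l ?(ltW e1) //.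
    by rewrite mulrN.
  rewrite -sumrN; apply: (le_trans (ler_sum _ (fun i _ => step i))).
  rewrite !big_split /= -!mulr_suml -mulr_sumr big_split /= -mulr_suml wsum sumrN.
  have -> : \sum_i weight U rhoe i = 1.
    under eq_bigr => i _ do rewrite we_ge //.
    by rewrite big_split /= -mulr_sumr wsum sumr_const card_ord -mulr_natr qn mulr1 subrK.
  by rewrite sumr_const card_ord -[q *+ _]mulr_natr qn !mul1r !addrA.
rewrite -Etau in upper.
set A := - complex.Re _ in lower *.
have key : (1 - e) * A <= (k%:R * q)^-1 +
    (1 - e) * (- \sum_i weight U rho i * ln_supp (d i) + ln c - ln (1 - e)) + e * - ln q.
  by apply: (le_trans lower); apply: le_trans upper; rewrite lerN2.
rewrite -(ler_pM2l e1); apply: (le_trans key).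
rewrite le_eqVlt; apply/orP; left; apply/eqP; field.
by rewrite !gt_eqF ?ltr0n.
Qed.

(** Ensures that there are PPT states to minimize over. *)
Lemma maximally_mixed_ppt : (0 < n1 * n2)%N ->
  is_ppt_state ((real_complex R (n1 * n2)%:R^-1)%:M : 'M[R[i]]_(n1 * n2)).
Proof.
move=> n0; have h0 : 0 <= (n1 * n2)%:R^-1 :> R by rewrite invr_ge0 ler0n.
split; last by rewrite ptranspose_scalar; exact: psd_real.
split; first exact: psd_real.
rewrite mxtrace_scalar -[LHS]mulr_natr -(rmorph_nat (real_complex R)) -rmorphM mulVf ?rmorph1 //.
by rewrite pnatr_eq0 -lt0n.
Qed.

(** If the support condition fails, the right side is [+oo]; otherwise the smoothing error can be
    made smaller than any [eta > 0]. *)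
Lemma min_ppt_le_rains rho sigma (m : \bar R) : is_state rho -> is_state sigma ->
  (forall sigma', is_ppt_state sigma' -> (m <= relative_entropy rho sigma')%E) ->
  (m <= relative_entropy rho sigma + (ln (trnorm (ptranspose sigma)))%:E)%E.
Proof.
move=> srho ssig mle; have [U [d [hU E d0]]] := psd_udiag (state_psd ssig).
have prho := state_psd srho.
rewrite {}E in ssig *; rewrite (relative_entropy_udiag _ prho hU).
case: asboolP => [hker|_]; last by rewrite addye ?leey.
rewrite -EFinD; apply/lee_addgt0Pr => eta eta0.
have n0 : (0 < n1 * n2)%N := state_dim_gt0 srho.
have m1 : 1 <= (n1 * n2)%:R :> R by rewrite ler1n.
have [e [k [e0 e12 k0 err]]] := smoothing_error_small m1 eta0.
have [tau ppt le] := ppt_approximation srho hU d0 ssig hker e0 e12 k0.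
apply: (le_trans (mle tau ppt)); apply: (le_trans le).
by rewrite -EFinD lee_fin lerD2l.
Qed.

End RainsBound.

Theorem theorem11 (R : realType) (n1 n2 : nat)
    (qubit : n1 = 2%N \/ n2 = 2%N)
    (rho : 'M[R[i]%type]_(n1 * n2)) (rho_state : is_state rho) :
  exists r : \bar R, is_rains_bound rho r /\ is_E_P rho r.
Proof.
have mixed := maximally_mixed_ppt R (state_dim_gt0 rho_state).
have [sigma ppt smin] := ppt_min rho_state (ex_intro _ _ mixed).
exists (relative_entropy rho sigma); split; split.
(* For a PPT state the trace norm of the partial transpose is the trace, hence [1]; the logarithmic
   term vanishes and the PPT minimum is a value of the Rains functional. *)
- exists sigma; first exact: ppt.1.
  by rewrite (trnorm_psd ppt.2) tr_ptranspose (state_Re_tr ppt.1) ln1 adde0.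
- by move=> _ [tau stau <-]; exact: min_ppt_le_rains.
- by exists sigma.
- by move=> _ [tau ptau <-]; exact: smin.
Qed.
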